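(* Let $(\mathcal{G}_{n})_{n}$ be a family in which, for each $n$, $\mathcal{G}_n$ is the orbit graph of an $\mathrm{SL}(2,\mathbb{Z})$-orbit of primitive $n$-squared origamis, all in $\mathcal{H}(2)$, or all in the Prym locus of $\mathcal{H}(4)$, or all in the Prym locus of $\mathcal{H}(6)$, constructed either with the parabolic generators or with the elliptic generators. Then $|\chi(\mathcal{G}_{n})|\to\infty$ as $n\to\infty$.
   Context: An origami is a translation surface $(M,\pi^{*}(dz))$ where $M$ is a connected compact Riemann surface and $\pi:M\to\mathbb{T}^2=\mathbb{C}/(\mathbb{Z}\oplus i\mathbb{Z})$ is a finite cover possibly branched only over $0$; it is $n$-squared if $\deg\pi=n$. Equivalently it is a pair $(h,v)\in \mathrm{Sym}(n)^2$ generating a transitive subgroup, up to simultaneous conjugation: take unit squares $sq(1),\dots,sq(n)$, glue the right side of $sq(i)$ to the left side of $sq(h(i))$ and the top of $sq(i)$ to the bottom of $sq(v(i))$. An origami is primitive if it is not a cover of another origami different from itself or the unit-square torus (equivalently, $\langle h,v\rangle$ is a primitive permutation group). $\mathcal{H}(k_1,\dots,k_s)$ is the moduli space (stratum) of translation surfaces $(M,\omega)$ where $\omega$ has zeros of orders $k_1,\dots,k_s$, $\sum k_j=2g-2$. $\mathrm{SL}(2,\mathbb{Z})$ acts on primitive $n$-squared origamis in a stratum (restricting the natural $\mathrm{SL}(2,\mathbb{R})$-action), with $T=\begin{bmatrix}1&1\\0&1\end{bmatrix}$, $S=\begin{bmatrix}1&0\\1&1\end{bmatrix}$ acting by $T(h,v)=(h,vh^{-1})$,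 $S(h,v)=(hv^{-1},v)$. Prym loci: for a discriminant $D>0$, $\mathcal{O}_D$ denotes the real quadratic order of discriminant $D$. The Prym locus of $\mathcal{H}(4)$ (resp. $\mathcal{H}(6)$) consists of those $(M,\omega)$ in the stratum for which $M$ admits a holomorphic involution $\iota$ with exactly $4$ (resp. $2$) fixed points with $\iota^*\omega=-\omega$, and whose Prym variety admits real multiplication by $\mathcal{O}_D$ for some $D$, with $\mathcal{O}_D\cdot\omega\subset\mathbb{C}\cdot\omega$. Orbit graphs: the parabolic generators are $T,S$; the elliptic generators are $R=\begin{bmatrix}0&-1\\1&0\end{bmatrix}=T^{-1}ST^{-1}$ and $U=\begin{bmatrix}0&1\\-1&1\end{bmatrix}=TS^{-1}$. The orbit graph with a generating pair $\{A,B\}$ has the elements of the orbit as vertices and, for each vertex $X$, one edge joining $X$ to $A(X)$ and one edge joining $X$ to $B(X)$, considered as an undirected graph (loops and multiple edges allowed); it is $4$-regular. The Euler characteristic is $\chi(\mathcal{G})=V-E+F$, where $V,E$ are the numbers of vertices and edges and $F$ is the number of faces of an embedding of $\mathcal{G}$ in a closed orientable surface of minimal genus; i.e. $\chi(\mathcal{G})=2-2g(\mathcal{G})$ with $g(\mathcal{G})$ the graph genus. *)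

(* Defs.v *)
(* MathComp / MathComp-Analysis; complex numbers are R[i] from real-closed. *)
From mathcomp Require Import all_boot all_order all_algebra all_fingroup.
From mathcomp Require Import primitive_action complex.
From mathcomp Require Import boolp classical_sets reals.
From mathcomp Require Import topology normedtype derive.
Import Order.TTheory GRing.Theory Num.Theory.
Import numFieldNormedType.Exports.

Set Implicit Arguments.
Unset Strict Implicit.
Unset Printing Implicit Defensive.

(** * Origamis *)

(* A pair (h, v): the right side of square i is glued to the left side of
   square h i, and the top of square i to the bottom of square v i. *)
Notation hv_pair n := ('S_n * 'S_n)%type.

Section Origami.
Variable n : nat.
Implicit Types p : hv_pair n.
Local Open Scope group_scope.

Definition monodromy p : {group 'S_n} := <<[set p.1; p.2]>>%G.

(* Primitivity of a permutation group includes transitivity, that is,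
   connectedness of the surface. *)
Definition primitive_origami p : bool :=
  [primitive (monodromy p), on [set: 'I_n] | 'P].

(* [~ h, v] is the function v o h o v^-1 o h^-1, since products of permutations
   act from left to right.  It sends a square to the next square having the same
   bottom-left corner after a full turn around this corner, so its cycles are
   the vertices of the surface, and a cycle of length k + 1 is a cone point of
   angle 2 pi (k + 1), i.e. a zero of order k of the differential. *)
Definition corner_perm p : 'S_n := [~ p.1, p.2].

Definition zero_orders p : seq nat :=
  [seq #|c|.-1 | c : {set 'I_n} <- enum (porbits (corner_perm p)) & 1 < #|c|].

Definition in_stratum p (ks : seq nat) : bool := perm_eq (zero_orders p) ks.

(* A holomorphic involution with iota^* omega = - omega of an origami with a
   single zero fixes this zero, hence covers z |-> -z on the torus: it permutes
   the squares, rotating them by pi.  Here s is the permutation of the squares. *)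
Definition prym_involution p (s : 'S_n) : Prop :=
  [/\ forall i, s (s i) = i,
      forall i, s (p.1 i) = p.1^-1 (s i)
    & forall i, s (p.2 i) = p.2^-1 (s i)].

(* The fixed points of the involution lie over the 2-torsion points of the torus.
   They are centres of squares, midpoints of vertical (right) sides, midpoints of
   horizontal (top) sides, and vertices; the bottom-left corner of i is sent to
   the top-right corner of s i, which is the bottom-left corner of v (h (s i)). *)
Definition fixed_point_count p (s : 'S_n) : nat :=
  (#|[set i | s i == i]| + #|[set i | s i == p.1 i]| + #|[set i | s i == p.2 i]|
   + #|[set c in porbits (corner_perm p) |
        [forall i in c, p.2 (p.1 (s i)) \in c]]|)%N.

End Origami.

(** * Homology *)

(* Integral 1-chains of the cell decomposition dual to the squares: its 0-cells
   are the centres of the squares, its 2-cells are centred at the vertices, and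
   (x, y) stands for the sum of x i times the straight path from the centre of i
   to the centre of h i and y i times the one from the centre of i to that of
   v i. *)
Notation chain n := ({ffun 'I_n -> int} * {ffun 'I_n -> int})%type.

Section Homology.
Variables (n : nat) (p : hv_pair n).
Local Notation h := p.1.
Local Notation v := p.2.
Local Open Scope ring_scope.

Implicit Types c d : chain n.

Definition is_cycle c : Prop :=
  forall j, c.1 ((h^-1)%g j) + c.2 ((v^-1)%g j) = c.1 j + c.2 j.

(* m gives the multiplicity of each 2-cell, as a function of the bottom-left
   corner.  The path from i to h i has the 2-cell of the top-right corner of i
   on its left and that of the bottom-right corner on its right; the path from
   i to v i has the top-left one on its left and the top-right one on its
   right. *)
Definition is_boundary c : Prop :=
  exists m : 'I_n -> int, (forall i, m (corner_perm p i) = m i) /\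
    forall i, c.1 i = m (v (h i)) - m (h i) /\ c.2 i = m (v i) - m (v (h i)).

Definition homologous c d : Prop := is_boundary (c - d).

(* Algebraic intersection of two cycles: the strands of c entering a square
   through its left (bottom) side cross once, positively (negatively), the
   strands of d leaving it through its top (right) side, after pushing d off c. *)
Definition intersection c d : int :=
  \sum_i (c.1 ((h^-1)%g i) * d.2 i - c.2 ((v^-1)%g i) * d.1 i).

(* The involution reverses the path from i to h i onto the one from
   s (h i) = h^-1 (s i) to s i, and similarly for v. *)
Definition invol_chain (s : 'S_n) c : chain n :=
  ([ffun j => - c.1 (s (h j))], [ffun j => - c.2 (s (v j))]).

Definition anti_invariant (s : 'S_n) c : Prop :=
  is_cycle c /\ homologous (invol_chain s c) (- c).

Definition lin_comb r (gamma : 'I_r -> chain n) (a : 'I_r -> int) : chain n :=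
  \sum_k gamma k *~ a k.

(* gamma is a Z-basis of H_1(M, Z)^-. *)
Definition anti_basis (s : 'S_n) r (gamma : 'I_r -> chain n) : Prop :=
  (forall k, anti_invariant s (gamma k)) /\
  forall c, anti_invariant s c ->
    exists! a : {ffun 'I_r -> int}, homologous c (lin_comb gamma a).

End Homology.

(** * Holomorphic 1-forms and the Prym variety *)

Section Prym.
Variables (R : realType) (n : nat) (p : hv_pair n).
Local Notation h := p.1.
Local Notation v := p.2.
Local Notation C := R[i].
Local Open Scope ring_scope.
Local Open Scope complex_scope.
Local Open Scope classical_set_scope.

Definition closed_square : set C^o :=
  (fun z => (0 <= complex.Re z <= 1) /\ (0 <= complex.Im z <= 1)).
Definition open_square : set C^o :=
  (fun z => (0 < complex.Re z < 1) /\ (0 < complex.Im z < 1)).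

(* A holomorphic 1-form on M is given by a primitive F i on each closed square,
   identified with [0,1] x [0,1]; the primitives agree up to constants along
   glued sides.  Conversely such a family is holomorphic across the sides by
   Morera's theorem, and at the vertices because it is continuous there. *)
Definition one_form : Type := 'I_n -> C -> C.

Definition holomorphic_form (F : one_form) : Prop :=
  [/\ forall i, {within closed_square, continuous (F i : C^o -> C^o)},
      forall i z, open_square z -> derivable (F i : C^o -> C^o) z 1,
      forall i, exists k : C, forall t : R, 0 <= t <= 1 ->
        F (h i) (0 +i* t) = F i (1 +i* t) + k
    & forall i, exists k : C, forall t : R, 0 <= t <= 1 ->
        F (v i) (t +i* 0) = F i (t +i* 1) + k].

Definition anti_invariant_form (s : 'S_n) (F : one_form) : Prop :=
  forall i, exists k : C, forall z, closed_square z ->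
    F (s i) ((1 +i* 1) - z) + F i z = k.

(* Omega(M)^- *)
Definition prym_form s F := holomorphic_form F /\ anti_invariant_form s F.

(* The differential of the origami, dz on each square. *)
Definition omega : one_form := fun _ z => z.

Definition right_path (F : one_form) (i : 'I_n) : C :=
  (F i (1 +i* 2^-1) - F i (2^-1 +i* 2^-1))
  + (F (h i) (2^-1 +i* 2^-1) - F (h i) (0 +i* 2^-1)).
Definition up_path (F : one_form) (i : 'I_n) : C :=
  (F i (2^-1 +i* 1) - F i (2^-1 +i* 2^-1))
  + (F (v i) (2^-1 +i* 2^-1) - F (v i) (2^-1 +i* 0)).

Definition period (F : one_form) (c : chain n) : C :=
  \sum_i ((c.1 i)%:~R * right_path F i + (c.2 i)%:~R * up_path F i).

Section Endomorphisms.
Variables (s : 'S_n) (r : nat) (gamma : 'I_r -> chain n).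
Implicit Types A : 'M[int]_r.

(* The endomorphism of the lattice H_1(M, Z)^- with basis gamma that sends
   gamma j to \sum_k A j k * gamma k. *)
Definition image A j : chain n := lin_comb gamma (A j).

(* Prym = (Omega^-)^* / H_1(M, Z)^-: an endomorphism of this complex torus is an
   endomorphism of the lattice whose real-linear extension is complex linear,
   i.e. whose transpose maps (the periods of) Omega^- to itself. *)
Definition prym_endomorphism A : Prop :=
  forall F, prym_form s F -> exists2 G, prym_form s G &
    forall j, period G (gamma j) = period F (image A j).

Definition self_adjoint A : Prop :=
  forall j k, intersection p (image A j) (gamma k)
              = intersection p (gamma j) (image A k).

Definition omega_eigenform A : Prop :=
  exists lambda : C, forall j,
    period omega (image A j) = lambda * period omega (gamma j).

(* O_D = Z[X]/(X^2 + b X + c) with D = b^2 - 4 c, acting through the image A of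
   X: the action is faithful, proper (no larger subring of Q.O_D acts),
   self-adjoint for the polarization, and has omega as an eigenvector. *)
Definition order_action (D : int) A : Prop :=
  exists b c : int,
  [/\ D = b ^+ 2 - 4%:Z * c,
      A *m A + b *: A + c%:M = 0,
      forall x y : int, x%:M + y *: A = 0 -> x = 0 /\ y = 0
    & forall (B : 'M[int]_r) (k x y : int), prym_endomorphism B -> k != 0 ->
        k *: B = x%:M + y *: A -> exists x' y' : int, B = x'%:M + y' *: A].

End Endomorphisms.

(* Real multiplication by O_D requires the Prym variety to have complex dimension
   2, so H_1(M, Z)^- has a basis gamma of 4 elements. *)
Definition prym_real_multiplication (s : 'S_n) (D : int) : Prop :=
  exists gamma : 'I_4 -> chain n, anti_basis p s gamma /\
  exists A : 'M[int]_4,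
  [/\ prym_endomorphism s gamma A, self_adjoint gamma A,
      order_action s gamma D A & omega_eigenform gamma A].

Definition in_prym (fixed_points : nat) : Prop :=
  exists s : 'S_n,
  [/\ prym_involution p s, fixed_point_count p s = fixed_points
    & exists2 D : int, 0 < D & prym_real_multiplication s D].

End Prym.

Inductive locus := StratumH2 | PrymH4 | PrymH6.

Definition in_locus (R : realType) (l : locus) n (p : hv_pair n) : Prop :=
  match l with
  | StratumH2 => in_stratum p [:: 2]
  | PrymH4 => in_stratum p [:: 4] /\ in_prym R p 4
  | PrymH6 => in_stratum p [:: 6] /\ in_prym R p 2
  end.

(** * Multigraphs, genus and Euler characteristic *)

Record multigraph := Multigraph {
  vertex : finType;
  edge : finType;
  source : edge -> vertex;
  target : edge -> vertex }.

Section EulerCharacteristic.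
Variable G : multigraph.

(* (e, false) and (e, true) are the two half-edges of e. *)
Definition dart : finType := (edge G * bool)%type.
Definition anchor (d : dart) : vertex G :=
  if d.2 then target d.1 else source d.1.

Definition flip (d : dart) : dart := (d.1, ~~ d.2).
Lemma flipK : involutive flip.
Proof. by case=> e b; rewrite /flip /= negbK. Qed.
Definition flip_perm : {perm dart} := perm (inv_inj flipK).

(* A cellular embedding of G in an oriented closed surface is a cyclic ordering
   of the darts around each vertex. *)
Definition rotation_system (rho : {perm dart}) : bool :=
  [forall d, porbit rho d == [set d' | anchor d' == anchor d]].

Definition num_faces (rho : {perm dart}) : nat :=
  #|porbits (flip_perm * rho)%g|.

(* For G connected, #|V| - #|E| + num_faces rho = 2 - 2 g where g is the genus of
   the surface, and a minimal-genus embedding is cellular: minimizing the genus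
   is maximizing the number of faces. *)
Definition euler_char : int :=
  (#|vertex G|%:Z - #|edge G|%:Z
   + (\max_(rho : {perm dart} | rotation_system rho) num_faces rho)%:Z)%R.

End EulerCharacteristic.

(** * The action of SL(2, Z) and orbit graphs *)

Inductive generator_pair := Parabolic | Elliptic.

Section OrbitGraph.
Variable n : nat.
Local Open Scope group_scope.

(* The origami of a pair: its class under simultaneous conjugation. *)
Definition origami_of (p : hv_pair n) : {set hv_pair n} :=
  [set (p.1 ^ g, p.2 ^ g) | g : 'S_n].

(* v h^-1 as a composition of functions is h^-1 * v here. *)
Definition T_pair (p : hv_pair n) : hv_pair n := (p.1, p.1^-1 * p.2).
Definition S_pair (p : hv_pair n) : hv_pair n := (p.2^-1 * p.1, p.2).

Lemma T_pair_inj : injective T_pair.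
Proof. by move=> [h v] [h' v'] [<-] /mulgI <-. Qed.
Lemma S_pair_inj : injective S_pair.
Proof. by move=> [h v] [h' v'] [e ev]; move: e; rewrite ev => /mulgI ->. Qed.

Definition T_act : {perm {set hv_pair n}} := perm (imset_inj T_pair_inj).
Definition S_act : {perm {set hv_pair n}} := perm (imset_inj S_pair_inj).

(* The image of SL(2, Z) = <T, S> in the permutations. *)
Definition sl2z_act : {group {perm {set hv_pair n}}} := <<[set T_act; S_act]>>%G.

(* R = T^-1 S T^-1 and U = T S^-1, where the rightmost factor acts first. *)
Definition generators (t : generator_pair) :
    {perm {set hv_pair n}} * {perm {set hv_pair n}} :=
  match t with
  | Parabolic => (T_act, S_act)
  | Elliptic => (T_act^-1 * S_act * T_act^-1, S_act^-1 * T_act)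
  end.

Definition sl2z_orbit (p : hv_pair n) : {set {set hv_pair n}} :=
  orbit 'P sl2z_act (origami_of p).

Definition generator (t : generator_pair) (b : bool) : {perm {set hv_pair n}} :=
  if b then (generators t).2 else (generators t).1.

Lemma generator_in t b : generator t b \in sl2z_act.
Proof.
have inT : T_act \in sl2z_act by rewrite mem_gen // !inE eqxx.
have inS : S_act \in sl2z_act by rewrite mem_gen // !inE eqxx orbT.
by case: t b => -[] //=; rewrite ?groupM ?groupV.
Qed.

Lemma generator_orbit t b p X :
  X \in sl2z_orbit p -> generator t b X \in sl2z_orbit p.
Proof.
move=> Xp; rewrite /sl2z_orbit -(orbit_eqP Xp).
exact: (mem_orbit 'P X (generator_in t b)).
Qed.

Definition orbit_vertex (p : hv_pair n) : finType :=
  {X : {set hv_pair n} | X \in sl2z_orbit p}.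

Definition move t b p (X : orbit_vertex p) : orbit_vertex p :=
  exist (fun Y => Y \in sl2z_orbit p) _ (generator_orbit t b (valP X)).

Definition orbit_graph (t : generator_pair) (p : hv_pair n) : multigraph :=
  @Multigraph (orbit_vertex p) (orbit_vertex p * bool)%type
    (fun e => e.1) (fun e => move t e.2 e.1).

End OrbitGraph.

(* Main.v *)
(* Counting faces.  A face of an embedding of the orbit graph is a closed walk, that
   is, a cyclically reduced word in the generators fixing an origami X.  Giving
   suitable weights to the corners of the faces, so that the total weight at a vertex
   is less than 42, every face of weight less than 42 is read by one of finitely many
   words, and none of these is trivial in PSL(2, Z) = Z/2 * Z/3.  So
   #faces <= (1 - 1/84) #vertices as soon as each of these words fixes a small
   proportion of the orbit.

   Fixed points.  Up to conjugation a nontrivial element of PSL(2, Z) is elliptic,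
   a power of T, or a positive word in T^-1 and S^-1 using both letters.  For the first
   two kinds, the fixed-point sets of suitable conjugates are pairwise disjoint, since
   a common fixed point is fixed by a word of the third kind.  A word w of the third
   kind fixes no primitive origami with many squares: the affine map acts on
   H^1(M minus zeros), modulo the two classes dx and dy, through a matrix of
   bounded size with bounded integral characteristic polynomial q.  If A is the matrix
   of w on <dx, dy>, Poincare duality and primitivity imply that n divides all the
   entries of q(A); and q(A) <> 0 because the Perron root of A is a simple eigenvalue
   of the action on cohomology. *)
Require Import Defs.
From mathcomp Require Import all_boot all_order all_algebra all_fingroup.
From mathcomp Require Import reals.
From mathcomp Require Import algC algnum primitive_action realalg boolp.
From mathcomp Require Import ring lra zify.
Import Order.TTheory GRing.Theory Num.Theory.

Set Implicit Arguments.
Unset Strict Implicit.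
Unset Printing Implicit Defensive.

(** Why n divides q(A): for an integral cocycle f, applying q of the affine action gives an exact
    cochain plus a constant one c. Primitivity makes c integral, since the potential of the exact
    part, taken modulo the integers, cuts the squares into blocks. Summation over the squares kills
    the exact part and leaves n c = q(A) applied to the sums of f. Integral cocycles dual to closed
    chains provide enough such sums, again by primitivity, to force q(A) / n to be integral. This
    bounds n only if q(A) is nonzero, which is why dx and dy are divided out before q is formed: the
    Perron root must not survive in the quotient. Where 42 comes from: 1/2 + 1/3 + 1/7 = 41/42. The
    relations of orders 2 and 3 do bound faces in the elliptic case, so a corner between two R darts
    must be worth 1/2 and one between two U darts 1/3; two mixed corners share 1/7. In the parabolic
    case four equal corners of 10/42 suffice. Half of the missing 1/42 pays for the light faces, and
    1/84 remains. *)

Local Open Scope ring_scope.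

(** * Integral action on a quotient of rational subspaces *)

(* Unlike [horner_mx], this makes sense for matrices of size 0. *)
Definition powmx (F : pzRingType) m (A : 'M[F]_m) k : 'M[F]_m := iter k (mulmx A) 1%:M.
Definition poly_mx (F : nzRingType) m (q : {poly F}) (A : 'M[F]_m) : 'M[F]_m :=
  \sum_(k < size q) q`_k *: powmx A k.

Lemma powmxSr (F : pzRingType) m (A : 'M[F]_m) k : powmx A k.+1 = powmx A k *m A.
Proof.
elim: k => [|k IH]; first by rewrite /powmx /= mul1mx mulmx1.
by rewrite /powmx iterS -/(powmx A k.+1) {1}IH mulmxA.
Qed.

Lemma powmxE (F : nzRingType) m (A : 'M[F]_m.+1) k : powmx A k = A ^+ k.
Proof. by elim: k => // k IH; rewrite /powmx /= -/(powmx A k) IH exprS. Qed.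

Lemma poly_mxE (F : comNzRingType) m (q : {poly F}) (A : 'M[F]_m.+1) :
  poly_mx q A = horner_mx A q.
Proof.
rewrite -{2}(coefK q) poly_def raddf_sum.
by apply: eq_bigr => k _; rewrite /= horner_mxZ rmorphXn /= horner_mx_X powmxE.
Qed.

Lemma map_powmx (F K : nzRingType) (g : {rmorphism F -> K}) m (A : 'M[F]_m) k :
  map_mx g (powmx A k) = powmx (map_mx g A) k.
Proof.
elim: k => [|k IH]; first by rewrite /powmx /= map_mx1.
by rewrite /powmx !iterS -!/(powmx _ k) map_mxM IH.
Qed.

Lemma poly_mx_char_poly (F : comNzRingType) m (A : 'M[F]_m) : poly_mx (char_poly A) A = 0.
Proof.
case: m A => [|m] A; first by apply/matrixP => -[].
by rewrite poly_mxE Cayley_Hamilton.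
Qed.

Lemma eigen_powmx (F : comNzRingType) m (A : 'M[F]_m) (x : 'rV_m) mu k :
  x *m A = mu *: x -> x *m powmx A k = mu ^+ k *: x.
Proof.
move=> xA; elim: k => [|k IH]; first by rewrite /powmx /= mulmx1 scale1r.
by rewrite powmxSr mulmxA IH -scalemxAl xA scalerA -exprSr.
Qed.

Lemma eigen_poly_mx (F : comNzRingType) m (q : {poly F}) (A : 'M[F]_m) (x : 'rV_m) mu :
  x *m A = mu *: x -> x *m poly_mx q A = q.[mu] *: x.
Proof.
move=> xA; rewrite /poly_mx mulmx_sumr horner_coef scaler_suml.
by apply: eq_bigr => k _; rewrite -scalemxAr (eigen_powmx _ xA) scalerA.
Qed.

Section Split.
Variables (F : fieldType) (m kz kb : nat) (Z : 'M[F]_(kz, m)) (BL : 'M[F]_(kb, m)).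

(** The quotient is represented by a complement of the intersection of [Z] and [BL] inside [Z]: [U]
    is a basis of it and [Pi] reads coordinates modulo [BL]. Induced maps are then plain
    matrices. *)
Lemma split_quotient : exists (U : 'M[F]_(\rank (Z :\: BL)%MS, m))
    (Pi : 'M[F]_(m, \rank (Z :\: BL)%MS)),
  [/\ (U <= Z)%MS, U *m Pi = 1%:M, BL *m Pi = 0
    & forall k (f : 'M_(k, m)), (f <= Z)%MS -> (f - f *m Pi *m U <= BL)%MS].
Proof.
set V := (Z :\: BL)%MS.
have V0 : (<<V>> :&: <<BL>> = 0)%MS.
  apply/eqP; rewrite -submx0 -(capmx_diff Z BL) -/V.
  by rewrite capmxS ?genmxE.
pose Q := proj_mx <<V>>%MS <<BL>>%MS.
exists (row_base V), (Q *m pinvmx (row_base V)); split.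
- by rewrite eq_row_base diffmxSl.
- rewrite mulmxA /Q proj_mx_id ?mulmxVp ?row_base_free //.
  by rewrite genmxE eq_row_base.
- by rewrite mulmxA /Q proj_mx_0 ?mul0mx // genmxE.
move=> k f fZ; rewrite mulmxA -(mulmxA (f *m Q)).
have fVB : (f <= <<V>> + <<BL>>)%MS.
  rewrite (submx_trans fZ) // -(addsmx_diff_cap_eq Z BL) addsmxS ?genmxE //.
  exact: capmxSr.
rewrite mulmxA mulmxKpV.
  by have := proj_mx_compl_sub fVB; rewrite genmxE.
by have := proj_mx_sub <<V>>%MS <<BL>>%MS f; rewrite eq_row_base genmxE.
Qed.
End Split.

Lemma coef_prod_XsubC_le (s : seq algC) (C : algC) : 0 <= C ->
  {in s, forall mu, `|mu| <= C} ->
  forall k, `|(\prod_(mu <- s) ('X - mu%:P))`_k| <= (1 + C) ^+ size s.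
Proof.
move=> C0; elim: s => [|mu s IH] sC k.
  by rewrite big_nil coef1; case: (k == 0)%N; rewrite ?normr1 ?normr0.
have le1 j := IH (fun nu h => sC nu (@mem_behead _ (mu :: s) nu h)) j.
rewrite big_cons mulrBl coefB mulrC coefMX mul_polyC coefZ exprS mulrDl mul1r.
rewrite (le_trans (ler_normB _ _)) // lerD //.
  by case: ifP => // _; rewrite normr0 exprn_ge0 // addr_ge0.
rewrite normrM ler_pM //.
by apply: sC; rewrite mem_head.
Qed.

(** Compare both sides of [x *m N = mu *: x] at a coordinate where [x] has maximal modulus.
    Eigenvectors are rows, hence column sums. *)
Lemma eigenvalue_le_colsum m (N : 'M[algC]_m) (C : algC) mu :
  (forall e, \sum_e' `|N e' e| <= C) -> eigenvalue N mu -> `|mu| <= C.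
Proof.
move=> NC /eigenvalueP [x xN x0].
have [e xe max_e] : exists2 e, x 0 e != 0 & forall e', `|x 0 e'| <= `|x 0 e|.
  have /rV0Pn [e0 xe0] := x0.
  have : exists e, forall e', e' \in enum 'I_m -> `|x 0 e'| <= `|x 0 e|.
    elim: (enum 'I_m) => [|a l [e le]]; first by exists e0.
    have [ae|ea] := real_leP (normr_real (x 0 a)) (normr_real (x 0 e)).
      by exists e => e'; rewrite inE => /predU1P [->|/le].
    exists a => e'; rewrite inE => /predU1P [->|/le] // h.
    exact: le_trans h (ltW ea).
  case=> e le; exists e; last by move=> e'; apply: le; rewrite mem_enum.
  by apply: contraNneq xe0 => xe;
    rewrite -normr_le0 (le_trans (le e0 _)) ?mem_enum // xe normr0.
have xe_gt0 : 0 < `|x 0 e| by rewrite normr_gt0.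
have := congr1 (fun y : 'rV_m => `|y 0 e|) xN; rewrite !mxE normrM => eq.
rewrite -(ler_pM2r xe_gt0) -eq (le_trans (ler_norm_sum _ _ _)) //.
rewrite (le_trans (y := \sum_e' `|x 0 e| * `|N e' e|)) //.
  by apply: ler_sum => e' _; rewrite normrM ler_wpM2r.
by rewrite -mulr_sumr mulrC ler_wpM2r.
Qed.

Section IntegerQuotient.
Variables (m kz kb : nat) (N : 'M[int]_m).
Variables (Z : 'M[rat]_(kz, m)) (BL : 'M[rat]_(kb, m)).
Local Notation NQ := (map_mx (intr : int -> rat) N).
Hypotheses (ZN : (Z *m NQ <= Z)%MS) (BN : (BL *m NQ <= BL)%MS).
Variable C : nat.
Hypothesis NC : forall e, (\sum_e' absz (N e' e) <= C)%N.

(** No lattice is chosen in the quotient, so integrality is read off the eigenvalues. The induced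
    matrix [P] is killed by the characteristic polynomial of [N]; its eigenvalues are therefore
    eigenvalues of [N], algebraic integers of modulus at most [C]. The rational coefficients of the
    characteristic polynomial of [P] are thus integers, and bounded ones. *)
Lemma quotient_charpoly : exists q : {poly int},
  [/\ q \is monic, size q = (\rank (Z :\: BL)%MS).+1,
      forall k, (absz (q`_k)%R <= C.+1 ^ (\rank (Z :\: BL)%MS))%N,
      forall f : 'rV_m, (f <= Z)%MS ->
        (f *m poly_mx (map_poly intr q) NQ <= BL)%MS
    & forall (K : numFieldType) (lambda : K), root (map_poly intr q) lambda ->
        exists y : 'rV[K]_m, [/\ (y <= map_mx ratr Z)%MS,
          ~~ (y <= map_mx ratr BL)%MS &
          (y *m map_mx intr N - lambda *: y <= map_mx ratr BL)%MS]].
Proof.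
have [U [Pi [UZ UPi BPi modBL]]] := split_quotient Z BL.
set D := \rank _ in U Pi UZ UPi BPi modBL *.
have [P PE] : {P | P = U *m NQ *m Pi} by eexists.
have NPi j0 (f : 'M_(j0, m)) : (f <= Z)%MS -> f *m NQ *m Pi = f *m Pi *m P.
  move=> /modBL/submxP [X fX].
  have {1}-> : f = f *m Pi *m U + X *m BL by rewrite -fX addrC subrK.
  have /submxP [Y BY] := BN.
  rewrite !mulmxDl -(mulmxA X) BY !mulmxA -(mulmxA _ BL) BPi mulmx0 addr0.
  by rewrite PE ?mulmxA.
have ZNk j0 (f : 'M_(j0, m)) j : (f <= Z)%MS -> (f *m powmx NQ j <= Z)%MS.
  move=> fZ; elim: j => [|j IH]; first by rewrite /powmx /= mulmx1.
  by rewrite powmxSr mulmxA (submx_trans (submxMr _ IH)).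
have NkPi j0 (f : 'M_(j0, m)) j : (f <= Z)%MS -> f *m powmx NQ j *m Pi = f *m Pi *m powmx P j.
  move=> fZ; elim: j => [|j IH]; first by rewrite /powmx /= !mulmx1.
  by rewrite !powmxSr !mulmxA NPi ?ZNk // IH.
have hPi j0 (f : 'M_(j0, m)) q : (f <= Z)%MS ->
    f *m poly_mx q NQ *m Pi = f *m Pi *m poly_mx q P.
  move=> fZ; rewrite /poly_mx !mulmx_sumr mulmx_suml; apply: eq_bigr => j _.
  by rewrite -!scalemxAr -scalemxAl NkPi.
have inBL (f : 'rV_m) : (f <= Z)%MS -> f *m Pi = 0 -> (f <= BL)%MS.
  by move=> fZ f0; have := modBL _ _ fZ; rewrite f0 mul0mx subr0.
have NP0 : poly_mx (char_poly NQ) P = 0.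
  by rewrite -[LHS]mul1mx -UPi -hPi // poly_mx_char_poly mulmx0 mul0mx.
pose r := char_poly P.
have [s rs] : {s : seq algC | map_poly ratr r = \prod_(mu <- s) ('X - mu%:P)}.
  have [s] := closed_field_poly_normal (map_poly ratr r : {poly algC}).
  rewrite (monicP _) ?scale1r; first by exists s.
  by rewrite map_monic char_poly_monic.
have size_s : size s = D.
  have := size_prod_XsubC s id; rewrite -rs size_map_poly size_char_poly.
  by case.
have s_eig mu : mu \in s -> eigenvalue (map_mx intr N : 'M[algC]_m) mu.
  move=> mus; have : root (map_poly ratr r) mu by rewrite rs root_prod_XsubC.
  have -> : map_poly ratr r = char_poly (map_mx ratr P : 'M[algC]_D).
    by rewrite map_char_poly.
  rewrite -eigenvalue_root_char => /eigenvalueP [x xP x0].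
  have NE : (map_mx intr N : 'M[algC]_m) = map_mx ratr NQ.
    by apply/matrixP => i j; rewrite !mxE ratr_int.
  rewrite eigenvalue_root_char NE -map_char_poly rootE.
  have := eigen_poly_mx (map_poly ratr (char_poly NQ)) xP.
  have -> : poly_mx (map_poly ratr (char_poly NQ)) (map_mx ratr P : 'M[algC]_D) = 0.
    rewrite -[0](map_mx0 (ratr : rat -> algC)) -NP0 /poly_mx map_mx_sum size_map_poly.
    by apply: eq_bigr => k _; rewrite coef_map -map_powmx map_mxZ.
  by rewrite mulmx0 => /esym/eqP; rewrite scaler_eq0 (negPf x0) orbF.
have s_aint mu : mu \in s -> mu \in Aint.
  move=> /s_eig; rewrite eigenvalue_root_char.
  move=> mur; apply: (root_monic_Aint mur (char_poly_monic _)).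
  have -> : char_poly (map_mx intr N : 'M[algC]_m) = map_poly intr (char_poly N).
    by rewrite map_char_poly.
  by apply/polyOverP => k; rewrite coef_map /= rpred_int.
have s_le mu : mu \in s -> `|mu| <= C%:R.
  move=> /s_eig; apply: eigenvalue_le_colsum => e.
  apply: le_trans (_ : (\sum_e' absz (N e' e))%:R <= _); last by rewrite ler_nat.
  by rewrite natr_sum ler_sum // => e' _; rewrite mxE -intr_norm -abszE.
have r_int k : ratr r`_k \in (Num.int : {pred algC}).
  apply: Cint_rat_Aint; first exact: Crat_rat.
  rewrite -coef_map rs.
  have : \prod_(mu <- s) ('X - mu%:P) \is a polyOver Aint.
    rewrite big_seq; apply: rpred_prod => mu mus.
    by rewrite rpredB ?polyOverX ?polyOverC ?s_aint.
  by move=> /polyOverP.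
have r_num k : r`_k = (numq r`_k)%:~R.
  have /intrP [z rz] := r_int k.
  have -> : r`_k = z%:~R by apply: (fmorph_inj (ratr : {rmorphism rat -> algC}));
    rewrite /= rz ratr_int.
  by rewrite numq_int.
pose q := map_poly numq r.
have qr : map_poly intr q = r.
  by apply/polyP => k; rewrite coef_map /= coef_map_id0 // -r_num.
have size_q : size q = D.+1 by rewrite -(size_map_inj_poly (@intr_inj rat)) ?qr ?size_char_poly.
exists q; split => //.
- by rewrite monicE lead_coefE -(inj_eq (@intr_inj rat)) -coef_map_id0 // qr size_q
  -(size_char_poly P) -lead_coefE (monicP (char_poly_monic _)).
- move=> k; rewrite -(ler_nat algC) natrX -addn1 natrD addrC -size_s.
  apply: le_trans (coef_prod_XsubC_le _ s_le k) => //.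
  by rewrite -rs coef_map /= -qr coef_map /= ratr_int -intr_norm -abszE.
- move=> f fZ; apply: inBL; last by rewrite qr hPi // poly_mx_char_poly mulmx0.
  rewrite /poly_mx mulmx_sumr summx_sub // => k _.
  by rewrite -scalemxAr scalemx_sub // ZNk.
move=> K lambda.
have -> : map_poly intr q = map_poly (ratr : rat -> K) r.
  by apply/polyP => k; rewrite -qr !coef_map /= ratr_int.
have -> : map_poly ratr r = char_poly (map_mx (ratr : rat -> K) P).
  by rewrite map_char_poly.
rewrite -eigenvalue_root_char => /eigenvalueP [x xP x0].
have NE : (map_mx intr N : 'M[K]_m) = map_mx ratr NQ.
  by apply/matrixP => i j; rewrite !mxE ratr_int.
(* Lifting the eigenvector of [P] by the basis [U] gives an eigenvector modulo [BL]. *)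
exists (x *m map_mx ratr U); split.
- by rewrite (submx_trans (submxMl _ _)) // map_submx.
- apply: contraNN x0 => /submxP [X xX].
  have := congr1 (fun y => y *m map_mx ratr Pi) xX.
  by rewrite -!mulmxA -!map_mxM UPi BPi map_mx1 mulmx1 map_mx0 mulmx0 => ->.
rewrite scalemxAl -xP -!mulmxA NE -!map_mxM -mulmxBr -map_mxB.
rewrite (submx_trans (submxMl _ _)) // map_submx PE.
apply: modBL; rewrite (submx_trans _ ZN) // submxMr //.
Qed.
End IntegerQuotient.

(** * Cochains and positive words *)

(* A pair (h, v) is encoded as the function [false |-> h], [true |-> v].  [pos_step true]
   is T^-1 : (h, v) |-> (h, h * v), and [pos_step false] is S^-1 : (h, v) |-> (v * h, v). *)
Definition pos_step n b (P : bool -> 'S_n) : bool -> 'S_n :=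
  fun x => if x == b then (P (~~ b) * P b)%g else P x.

Fixpoint pos_act n w (P : bool -> 'S_n) : bool -> 'S_n :=
  if w is b :: w' then pos_act w' (pos_step b P) else P.

(* The top-right corner of square [j] is not a zero of the differential. *)
Definition regular n (P : bool -> 'S_n) (j : 'I_n) : bool :=
  P true (P false j) == P false (P true j).

(* The action of [step_cochain] on the constant cochains, spanned by dx and dy. *)
Definition step_const (K : nmodType) b (c : bool -> K) : bool -> K :=
  fun x => if x == b then c (~~ b) + c b else c x.

Fixpoint pull_consts (K : nmodType) w (c : bool -> K) : bool -> K :=
  if w is b :: w' then pull_consts w' (step_const b c) else c.

Section Cochains.
Variables (n : nat).
Implicit Types (P : bool -> 'S_n) (w : seq bool).

Section Nmod.
Variable K : nmodType.
Implicit Types (f : bool -> 'I_n -> K).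

(* The value of a cochain on the edges of [pos_step b P], which are paths of [P]. *)
Definition step_cochain b P f : bool -> 'I_n -> K :=
  fun x i => if x == b then f (~~ b) i + f b (P (~~ b) i) else f x i.

Fixpoint pull w P f : bool -> 'I_n -> K :=
  if w is b :: w' then pull w' (pos_step b P) (step_cochain b P f) else f.

Lemma pull_const w P (c : bool -> K) : pull w P (fun x _ => c x) = fun x _ => pull_consts w c x.
Proof. by elim: w P c => //= b w IH P c; apply: (IH (pos_step b P) (step_const b c)). Qed.

(** Summation over the squares intertwines the action on cochains with the action on constants; this
    is how the matrix A of [w] on dx and dy is recovered from any cochain. *)
Lemma sum_pull w P f x :
  \sum_i pull w P f x i = pull_consts w (fun y => \sum_i f y i) x.
Proof.
elim: w P f => //= b w IH P f; rewrite IH; congr (pull_consts w _ x).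
apply/funext => y; rewrite /step_cochain /step_const; case: ifP => // _.
by rewrite big_split /=; congr (_ + _); rewrite [RHS](reindex_inj (@perm_inj _ (P (~~ b)))).
Qed.

Lemma pull_add w P f1 f2 :
  pull w P (fun x i => f1 x i + f2 x i) = fun x i => pull w P f1 x i + pull w P f2 x i.
Proof.
elim: w P f1 f2 => //= b w IH P f1 f2;
  apply: etrans _ (IH (pos_step b P) (step_cochain b P f1) (step_cochain b P f2));
    congr (pull w _ _).
by apply/funext => x; apply/funext => i; rewrite /step_cochain; case: ifP => // _;
  rewrite addrACA.
Qed.

Lemma pull0 w P : pull w P (fun _ _ => 0) = fun _ _ => 0.
Proof.
elim: w P => //= b w IH P; apply: etrans _ (IH (pos_step b P)); congr (pull w _ _).
by apply/funext => x; apply/funext => i; rewrite /step_cochain addr0 if_same.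
Qed.

Lemma pull_sum (T : Type) (r : seq T) w P (F : T -> bool -> 'I_n -> K) :
  pull w P (fun x i => \sum_(t <- r) F t x i) = fun x i => \sum_(t <- r) pull w P (F t) x i.
Proof.
elim: r => [|t r IH].
  have E G : (fun x i => \sum_(t <- [::]) G t x i) = (fun _ _ => 0) :> (bool -> 'I_n -> K).
    by apply/funext => x; apply/funext => i; rewrite big_nil.
  by rewrite (E _ F) (E _ (fun t => pull w P (F t))) pull0.
transitivity (fun x i => pull w P (F t) x i + pull w P (fun x i => \sum_(t <- r) F t x i) x i).
  apply: etrans _ (pull_add _ _ _ _); congr (pull w P _).
  by apply/funext => x; apply/funext => i; rewrite big_cons.
by apply/funext => x; apply/funext => i; rewrite big_cons IH.
Qed.

End Nmod.

Lemma pull_map (K K' : nmodType) (phi : {additive K -> K'}) w P f :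
  pull w P (fun x i => phi (f x i)) = fun x i => phi (pull w P f x i).
Proof.
elim: w P f => //= b w IH P f; apply: etrans _ (IH (pos_step b P) (step_cochain b P f));
  congr (pull w _ _).
by apply/funext => x; apply/funext => i; rewrite /step_cochain; case: ifP => // _;
  rewrite raddfD.
Qed.

Lemma pull_consts_map (K K' : nmodType) (phi : {additive K -> K'}) w c :
  pull_consts w (fun x => phi (c x)) = fun x => phi (pull_consts w c x).
Proof.
elim: w c => //= b w IH c; apply: etrans _ (IH (step_const b c)); congr (pull_consts w _).
by apply/funext => x; rewrite /step_const; case: ifP => // _; rewrite raddfD.
Qed.

Section Ring.
Variable K : comNzRingType.
Implicit Types (f : bool -> 'I_n -> K).

Definition curvature P f j : K :=
  f false j + f true (P false j) - f true j - f false (P true j).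

(* These represent the cohomology of the surface minus its zeros. *)
Definition cocycle P f := forall j, regular P j -> curvature P f j = 0.

Definition coboundary P (u : 'I_n -> K) : bool -> 'I_n -> K := fun x i => u (P x i) - u i.

Lemma regular_step b P j : regular (pos_step b P) j = regular P (P (~~ b) j).
Proof. by rewrite /regular /pos_step; case: b; rewrite /= !permM. Qed.

(** The top-right corner of square [j] after the shear is that of [P (~~ b) j] before it. *)
Lemma curvature_step b P f j : curvature (pos_step b P) (step_cochain b P f) j =
  curvature P f (P (~~ b) j).
Proof. by rewrite /curvature /pos_step /step_cochain; case: b; rewrite /= !permM; ring. Qed.

Lemma cocycle_pull w P f : cocycle P f -> cocycle (pos_act w P) (pull w P f).
Proof.
elim: w P f => //= b w IH P f fP; apply: IH => j.
by rewrite regular_step curvature_step; apply: fP.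
Qed.

Lemma pull_coboundary w P u : pull w P (coboundary P u) = coboundary (pos_act w P) u.
Proof.
elim: w P => //= b w IH P; apply: etrans _ (IH (pos_step b P)); congr (pull w _ _).
apply/funext => x; apply/funext => i; rewrite /step_cochain /coboundary /pos_step.
by rewrite /=; case: ifP => _ //; rewrite permM; ring.
Qed.

Lemma pull_scale w P c f : pull w P (fun x i => c * f x i) = fun x i => c * pull w P f x i.
Proof.
elim: w P f => //= b w IH P f; apply: etrans _ (IH (pos_step b P) (step_cochain b P f));
  congr (pull w _ _).
by apply/funext => x; apply/funext => i; rewrite /step_cochain; case: ifP => // _;
  rewrite mulrDr.
Qed.

End Ring.

Lemma pull_ge0 (K : numDomainType) w P (f : bool -> 'I_n -> K) :
  (forall x i, 0 <= f x i) -> forall x i, 0 <= pull w P f x i.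
Proof.
elim: w P f => //= b w IH P f f0; apply: IH => x i.
by rewrite /step_cochain; case: ifP => // _; rewrite addr_ge0.
Qed.

End Cochains.

Lemma pull_consts_le (K : numDomainType) w (c : bool -> K) M :
  (forall x, `|c x| <= M) -> forall x, `|pull_consts w c x| <= 2 ^+ size w * M.
Proof.
elim: w c M => [|b w IH] c M cM x /=; first by rewrite mul1r.
rewrite exprSr -mulrA; apply: IH => y; rewrite /step_const; case: ifP => _.
  by rewrite mulrDl mul1r (le_trans (ler_normD _ _)) ?lerD.
by rewrite (le_trans (cM y)) // mulrDl mul1r lerDl (le_trans _ (cM y)).
Qed.

(** * Cochains as row vectors, and dimension counts *)

Section Edges.
Variables (n : nat) (P : bool -> 'S_n).
Local Notation E := (bool * 'I_n)%type.
Local Notation m := #|{: E}|.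

Definition edge_indicator (K : pzSemiRingType) (e : E) : bool -> 'I_n -> K :=
  fun x i => ((x, i) == e)%:R.

Definition row_of (K : Type) (f : bool -> 'I_n -> K) : 'rV[K]_m :=
  \row_k f (enum_val k).1 (enum_val k).2.

Definition coch_of (K : Type) (y : 'rV[K]_m) : bool -> 'I_n -> K :=
  fun x i => y 0 (enum_rank (x, i)).

Lemma coch_ofK K : cancel (@coch_of K) (@row_of K).
Proof.
by move=> y; apply/rowP => k; rewrite mxE /coch_of -surjective_pairing enum_valK.
Qed.

Lemma row_ofK K : cancel (@row_of K) (@coch_of K).
Proof.
move=> f; apply/funext => x; apply/funext => i.
by rewrite /coch_of mxE enum_rankK.
Qed.

Lemma sum_edge (K : pzSemiRingType) (f : bool -> 'I_n -> K) (h : E -> K) :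
  \sum_(k < m) row_of f 0 k * h (enum_val k) = \sum_(e : E) f e.1 e.2 * h e.
Proof.
rewrite [RHS]big_enum_val /=; by apply: eq_bigr => k _; rewrite mxE.
Qed.

Lemma sum_edge_indicator (K : pzSemiRingType) (f : bool -> 'I_n -> K) x i :
  \sum_(e : E) f e.1 e.2 * edge_indicator K e x i = f x i.
Proof.
rewrite (bigD1 (x, i)) //= /edge_indicator eqxx mulr1 big1 ?addr0 // => e ne.
by rewrite eq_sym (negPf ne) mulr0.
Qed.

Definition coboundary_mx (K : comNzRingType) : 'M[K]_(n, m) :=
  \matrix_(j, k) coboundary P (fun i => (i == j)%:R) (enum_val k).1 (enum_val k).2.
Definition constant_cochain_mx (K : comNzRingType) : 'M[K]_(#|{: bool}|, m) :=
  \matrix_(b, k) (enum_val b == (enum_val k).1)%:R.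
(** Irregular corners keep a zero column, so that the kernel is the space of cocycles of the surface
    without its zeros. *)
Definition curvature_mx (K : comNzRingType) : 'M[K]_(m, n) :=
  \matrix_(k, j) (if regular P j then curvature P (edge_indicator K (enum_val k)) j else 0).

Lemma row_of_coboundary (K : comNzRingType) (u : 'I_n -> K) :
  row_of (coboundary P u) = (\row_j u j) *m coboundary_mx K.
Proof.
have pick (i : 'I_n) : \sum_j u j * (i == j)%:R = u i.
  by rewrite (bigD1 i) //= eqxx mulr1 big1 ?addr0 // => j ji; rewrite eq_sym (negPf ji) mulr0.
apply/rowP => k; rewrite !mxE /coboundary -(pick (P _ _)) -(pick (enum_val k).2) -sumrB.
by apply: eq_bigr => j _; rewrite !mxE -mulrBr.
Qed.

Lemma row_of_constant (K : comNzRingType) (c : bool -> K) :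
  row_of (fun x _ => c x) = (\row_b c (enum_val b)) *m constant_cochain_mx K.
Proof.
apply/rowP => k; rewrite !mxE (bigD1 (enum_rank (enum_val k).1)) //= !mxE.
rewrite enum_rankK eqxx mulr1 big1 ?addr0 // => b bk; rewrite !mxE.
by rewrite -(inj_eq enum_rank_inj) enum_valK (negPf bk) mulr0.
Qed.

Lemma curvature_sum (K : comNzRingType) (f : bool -> 'I_n -> K) j :
  curvature P f j = \sum_(e : E) f e.1 e.2 * curvature P (edge_indicator K e) j.
Proof.
rewrite /curvature; under eq_bigr do rewrite !mulrBr !mulrDr.
by rewrite !sumrB big_split /= !sum_edge_indicator.
Qed.

Lemma row_of_curvature (K : comNzRingType) (f : bool -> 'I_n -> K) :
  row_of f *m curvature_mx K = \row_j (if regular P j then curvature P f j else 0).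
Proof.
apply/rowP => j; rewrite !mxE; case: ifP => rj.
  rewrite curvature_sum -(sum_edge f (fun e => curvature P (edge_indicator K e) j)).
  by apply: eq_bigr => k _; rewrite [curvature_mx _ _ _]mxE rj.
by rewrite big1 // => k _; rewrite [curvature_mx _ _ _]mxE rj mulr0.
Qed.

Lemma sub_exact_constP (F : fieldType) (f : bool -> 'I_n -> F) :
  reflect (exists u c, f = fun x i => coboundary P u x i + c x)
    (row_of f <= col_mx (coboundary_mx F) (constant_cochain_mx F))%MS.
Proof.
have splitE u c : row_of (fun x i => coboundary P u x i + c x) =
  row_of (coboundary P u) + row_of (fun x _ => c x).
  by apply/rowP => k; rewrite !mxE.
apply: (iffP idP) => [/submxP [D]|[u [c ->]]].
  rewrite -[D]hsubmxK mul_row_col => fD.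
  exists (fun j => lsubmx D 0 j), (fun b => rsubmx D 0 (enum_rank b)).
  rewrite -[LHS]row_ofK fD -[RHS]row_ofK; congr coch_of.
  rewrite splitE row_of_coboundary row_of_constant.
  rewrite (_ : \row_j lsubmx D 0 j = lsubmx D); last by apply/rowP => j; rewrite mxE.
  rewrite (_ : \row_b _ = rsubmx D) //.
  by apply/rowP => j; rewrite mxE enum_valK.
rewrite splitE row_of_coboundary row_of_constant -mul_row_col; exact: submxMl.
Qed.

Lemma sub_cocycleP (F : fieldType) (f : bool -> 'I_n -> F) :
  reflect (cocycle P f) (row_of f <= kermx (curvature_mx F))%MS.
Proof.
rewrite sub_kermx row_of_curvature; apply: (iffP eqP) => [/rowP f0 j rj|f0].
  by have := f0 j; rewrite !mxE rj.
by apply/rowP => j; rewrite !mxE; case: ifP => // rj; apply: f0.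
Qed.

Lemma cocycle_coboundary (K : comNzRingType) (u : 'I_n -> K) : cocycle P (coboundary P u).
Proof. by move=> j /eqP r; rewrite /curvature /coboundary r; ring. Qed.

Lemma cocycle_const (K : comNzRingType) (c : bool -> K) : cocycle P (fun x _ => c x).
Proof. by move=> j _; rewrite /curvature; ring. Qed.

Lemma map_coboundary_mx (F K : comNzRingType) (phi : {rmorphism F -> K}) :
  map_mx phi (coboundary_mx F) = coboundary_mx K.
Proof. by apply/matrixP => i j; rewrite !mxE /coboundary rmorphB /= !rmorph_nat. Qed.

Lemma map_constant_cochain_mx (F K : comNzRingType) (phi : {rmorphism F -> K}) :
  map_mx phi (constant_cochain_mx F) = constant_cochain_mx K.
Proof. by apply/matrixP => i j; rewrite !mxE rmorph_nat. Qed.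

Section Rank.
Hypothesis conn : forall S : {set 'I_n}, (exists i, i \in S) ->
  (forall x i, i \in S -> P x i \in S) -> S = setT.
Variable F : fieldType.

Lemma connected_const (T : eqType) (u : 'I_n -> T) : (forall x i, u (P x i) = u i) ->
  forall i j, u i = u j.
Proof.
move=> uP i j; have : j \in [set k | u k == u i].
  rewrite (_ : [set k | u k == u i] = setT) ?inE //; apply: conn.
    by exists i; rewrite inE.
  by move=> x k; rewrite !inE uP.
by rewrite inE => /eqP.
Qed.

Lemma rank_coboundary_mx : (n <= (\rank (coboundary_mx F)).+1)%N.
Proof.
have : (\rank (kermx (coboundary_mx F)) <= 1)%N.
  have : (kermx (coboundary_mx F) <= (const_mx 1 : 'rV[F]_n))%MS.
    apply/row_subP => i; set u := row i _.
    have u0 : u *m coboundary_mx F = 0 by apply/eqP; rewrite -sub_kermx row_sub.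
    have uE : u = \row_j u 0 j by apply/rowP => j; rewrite mxE.
    have uP x j : u 0 (P x j) = u 0 j.
      have : row_of (coboundary P (fun j => u 0 j)) = row_of (fun _ _ => 0).
        by rewrite row_of_coboundary -uE u0; apply/rowP => k; rewrite !mxE.
      move=> /(can_inj (@row_ofK F)) /(congr1 (fun f => f x j)) /eqP.
      by rewrite /coboundary subr_eq0 => /eqP.
    have uc := connected_const uP.
    case: (posnP n) => [n0|n_gt0].
      rewrite (_ : u = 0) ?sub0mx //; apply/rowP => -[j jn]; by exfalso; rewrite n0 in jn.
    pose j0 := Ordinal n_gt0; rewrite (_ : u = u 0 j0 *: const_mx 1) ?scalemx_sub //.
    by apply/rowP => j; rewrite [RHS]mxE [const_mx _ _ _]mxE mulr1 (uc j j0).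
  by move=> /mxrankS /leq_trans; apply; apply: rank_leq_row.
rewrite mxrank_ker; lia.
Qed.

(** A linear relation between the curvatures, set to 0 at the irregular corners and tested on the
    indicator of one edge, is invariant under both permutations. It is therefore constant, hence
    zero since an irregular corner exists. *)
Lemma rank_curvature_mx : (0 < #|[set j | ~~ regular P j]|)%N ->
  (n <= \rank (curvature_mx F) + #|[set j | ~~ regular P j]|)%N.
Proof.
set S := [set j | _] => S0.
pose D : 'M[F]_n := \sum_(j in S) delta_mx j j.
have rD : (\rank D <= #|S|)%N.
  rewrite -sum1_card; apply: (big_ind2 (fun (A : 'M[F]_n) k => \rank A <= k)%N).
  - by rewrite mxrank0.
  - by move=> A k B l Ak Bl; rewrite (leq_trans (mxrank_add _ _)) ?leq_add.
  - by move=> j _; rewrite mxrank_delta.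
have : (kermx (curvature_mx F)^T <= D)%MS.
  apply/row_subP => i.
  have : row i (kermx (curvature_mx F)^T) *m (curvature_mx F)^T = 0 by apply/eqP;
    rewrite -sub_kermx row_sub.
  move: (row i _) => u u0; pose v j : F := if regular P j then u 0 j else 0.
  have v0 f : \sum_j v j * curvature P f j = 0.
    have : (u *m (curvature_mx F)^T *m (row_of f)^T) 0 0 = 0 by rewrite u0 mul0mx mxE.
    rewrite -mulmxA -trmx_mul row_of_curvature mxE; apply: etrans; apply: eq_bigr => j _.
    by rewrite !mxE /v; case: ifP; rewrite ?mul0r ?mulr0.
  have vP x j : v (P x j) = v j.
    have pick (s : 'I_n -> 'I_n) k (inj_s : injective s) : \sum_l v l * (s l == s k)%:R = v k.
      rewrite (bigD1 k) //= eqxx mulr1 big1 ?addr0 // => l lk.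
      by rewrite (inj_eq inj_s) (negPf lk) mulr0.
    have := v0 (edge_indicator F (~~ x, P x j)); rewrite /curvature /edge_indicator.
    under eq_bigr do rewrite !mulrBr !mulrDr !xpair_eqE.
    rewrite !sumrB big_split /=.
    have pick1 := pick id (P x j) (@inj_id _).
    have pickP y := pick _ j (@perm_inj _ (P y)).
    case: x pick1 => /= pick1; rewrite pickP pick1 -mulr_suml mulr0 ?addr0 ?add0r ?subr0 =>
      /eqP;
      by rewrite subr_eq0 => /eqP.
  have vc := connected_const vP.
  have [j1 j1S] : exists j, j \in S by apply/set0Pn; rewrite -card_gt0.
  have vz j : v j = 0.
    by rewrite (vc j j1) /v; move: j1S; rewrite inE => /negPf ->.
  have -> : u = u *m D.
    apply/rowP => j; rewrite mulmx_sumr summxE.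
    have [jS|jS] := boolP (j \in S).
      rewrite (bigD1 j) //= big1 ?addr0.
        by rewrite mxE (bigD1 j) //= big1 ?addr0 => [|k kj];
          rewrite [delta_mx _ _ _ _]mxE ?eqxx ?mulr1 // (negPf kj) mulr0.
      move=> k /andP [_ kj]; rewrite mxE big1 // => l _.
      by rewrite [delta_mx _ _ _ _]mxE [j == k]eq_sym (negPf kj) andbF mulr0.
    rewrite big1 => [|k kS].
      by have := vz j; rewrite /v; move: jS; rewrite inE negbK => ->.
    rewrite mxE big1 // => l _; rewrite [delta_mx _ _ _ _]mxE.
    by rewrite (_ : j == k = false) ?andbF ?mulr0 //; apply: contraNF jS => /eqP ->.
  exact: submxMl.
move=> /mxrankS; rewrite mxrank_ker mxrank_tr => h.
by have := leq_trans h rD; lia.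
Qed.
End Rank.
End Edges.

(** * The affine map of a fixed origami acting on cohomology *)

Section Return.
Variables (n : nat) (P : bool -> 'S_n) (w : seq bool) (g : 'S_n).
Hypothesis Pg : forall x, pos_act w P x = (P x ^ g)%g.
Local Notation E := (bool * 'I_n)%type.
Local Notation m := #|{: E}|.

(** The pulled cochain lives on [pos_act w P], which is [P] relabelled by [g]; composing with [g]
    brings it back to [P]. This is the pullback by the affine map. *)
Definition return_map (K : nmodType) (f : bool -> 'I_n -> K) : bool -> 'I_n -> K :=
  fun x i => pull w P f x (g i).

Lemma return_const (K : nmodType) (c : bool -> K) : return_map (fun x _ => c x) = fun x _ =>
  pull_consts w c x.
Proof. by rewrite /return_map pull_const. Qed.

Lemma sum_return (K : nmodType) (f : bool -> 'I_n -> K) x :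
  \sum_i return_map f x i = pull_consts w (fun y => \sum_i f y i) x.
Proof. by rewrite -(sum_pull w P) [RHS](reindex_inj (@perm_inj _ g)). Qed.

Lemma pos_act_conj x i : pos_act w P x (g i) = g (P x i).
Proof. by rewrite Pg permJ. Qed.

Lemma return_coboundary (K : comNzRingType) (u : 'I_n -> K) : return_map (coboundary P u) =
  coboundary P (u \o g).
Proof.
by apply/funext => x; apply/funext => i;
  rewrite /return_map pull_coboundary /coboundary /= pos_act_conj.
Qed.

Lemma cocycle_return (K : comNzRingType) (f : bool -> 'I_n -> K) : cocycle P f -> cocycle P
  (return_map f).
Proof.
move=> /(@cocycle_pull _ _ w) fP j /eqP rj; have := fP (g j);
  rewrite /regular /curvature !pos_act_conj.
by move=> fg; rewrite -(fg _) ?rj.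
Qed.

Lemma return_add (K : nmodType) (f1 f2 : bool -> 'I_n -> K) :
  return_map (fun x i => f1 x i + f2 x i) = fun x i => return_map f1 x i + return_map f2 x i.
Proof. by rewrite /return_map pull_add. Qed.

Lemma return_scale (K : comNzRingType) c (f : bool -> 'I_n -> K) :
  return_map (fun x i => c * f x i) = fun x i => c * return_map f x i.
Proof. by rewrite /return_map pull_scale. Qed.

Lemma return_additive (K K' : nmodType) (phi : {additive K -> K'}) f :
  return_map (fun x i => phi (f x i)) = fun x i => phi (return_map f x i).
Proof. by rewrite /return_map pull_map. Qed.

Definition return_mx : 'M[int]_m :=
  \matrix_(e, e') return_map (edge_indicator int (enum_val e)) (enum_val e').1 (enum_val e').2.

Lemma row_of_return (K : comNzRingType) (f : bool -> 'I_n -> K) :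
  row_of (return_map f) = row_of f *m map_mx intr return_mx.
Proof.
have fE : f = fun x i => \sum_(e : E) f e.1 e.2 * edge_indicator K e x i.
  by apply/funext => x; apply/funext => i; rewrite sum_edge_indicator.
apply/rowP => k; rewrite mxE {1}fE /return_map pull_sum mxE.
rewrite [LHS](_ : _ = \sum_(e : E) f e.1 e.2 *
   (return_map (edge_indicator int e) (enum_val k).1 (enum_val k).2)%:~R); last first.
  apply: eq_bigr => e _; rewrite pull_scale; congr (_ * _).
  have -> : edge_indicator K e = fun x i => (edge_indicator int e x i)%:~R.
    by apply/funext => x; apply/funext => i; rewrite /edge_indicator rmorph_nat.
  by rewrite (pull_map (intr : {additive int -> K})).
rewrite -(sum_edge f (fun e => (return_map (edge_indicator int e) _ _)%:~R)).
by apply: eq_bigr => e _; rewrite !mxE.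
Qed.

Lemma row_of_iter_return (K : comNzRingType) (f : bool -> 'I_n -> K) k :
  row_of (iter k (@return_map K) f) = row_of f *m powmx (map_mx intr return_mx) k.
Proof.
elim: k => [|k IH]; first by rewrite /powmx /= mulmx1.
by rewrite iterS row_of_return IH powmxSr mulmxA.
Qed.

(** The entries are nonnegative, so a column sum is the image of the constant cochain 1, and each
    letter at most doubles a constant. *)
Lemma return_mx_colsum e : (\sum_e' absz (return_mx e' e) <= 2 ^ size w)%N.
Proof.
set x := (enum_val e).1; set i := (enum_val e).2.
rewrite -lez_nat (big_morph Posz PoszD (erefl _)) /=.
have -> : \sum_e' `|return_mx e' e|%N%:Z = return_map (fun _ _ => 1 : int) x i.
  have -> : (fun _ _ => 1 : int) = fun y j => \sum_(e' : E) 1 * edge_indicator int e' y j.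
    by apply/funext => y; apply/funext => j; rewrite (sum_edge_indicator (fun _ _ => 1)).
  rewrite /return_map pull_sum [RHS]big_enum_val /=; apply: eq_bigr => e' _.
  by rewrite pull_scale mul1r mxE gez0_abs // pull_ge0.
rewrite return_const (le_trans (ler_norm _)) //.
by rewrite (le_trans (pull_consts_le (M := 1) _ _ _)) // mulr1 -natrX natz.
Qed.

Hypothesis conn : forall S : {set 'I_n}, (exists i, i \in S) ->
  (forall x i, i \in S -> P x i \in S) -> S = setT.
Local Notation d := #|[set j | ~~ regular P j]|.
Hypothesis d_gt0 : (0 < d)%N.

Lemma return_charpoly : exists q : {poly int},
  [/\ q \is monic, (size q <= d.+2)%N,
      forall k, (absz (q`_k)%R <= (2 ^ size w).+1 ^ d.+1)%N,
      forall f : bool -> 'I_n -> rat, cocycle P f -> exists u c, forall x i,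
        \sum_(k < size q) (q`_k)%:~R * iter k (@return_map rat) f x i = coboundary P u x i + c x
    & forall (K : numFieldType) (lambda : K), root (map_poly intr q) lambda ->
        exists y : bool -> 'I_n -> K,
          (forall u c, y <> fun x i => coboundary P u x i + c x) /\
          exists u c, forall x i, return_map y x i = lambda * y x i + coboundary P u x i + c x].
Proof.
pose BL (K : comNzRingType) := col_mx (coboundary_mx P K) (constant_cochain_mx n K).
pose Z := kermx (curvature_mx P rat).
have sBZ : (BL rat <= Z)%MS.
  apply/row_subP => i; rewrite -[row i _](@coch_ofK n); apply/sub_cocycleP.
  have : (row_of (coch_of (row i (BL rat))) <= BL rat)%MS by rewrite coch_ofK row_sub.
  move=> /sub_exact_constP [u [c ->]] j rj.
  have := cocycle_coboundary u rj; have := cocycle_const c rj; rewrite /curvature => h1 h2.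
  rewrite -[RHS]addr0 -{1}h1 -h2; ring.
have ZN : (Z *m map_mx intr return_mx <= Z)%MS.
  apply/row_subP => i; rewrite row_mul -[row i _](@coch_ofK n) -row_of_return.
  by apply/sub_cocycleP/cocycle_return/sub_cocycleP; rewrite coch_ofK row_sub.
have BN : (BL rat *m map_mx intr return_mx <= BL rat)%MS.
  apply/row_subP => i; rewrite row_mul -[row i _](@coch_ofK n) -row_of_return.
  have : (row_of (coch_of (row i (BL rat))) <= BL rat)%MS by rewrite coch_ofK row_sub.
  move=> /sub_exact_constP [u [c ->]]; apply/sub_exact_constP.
  by exists (u \o g), (pull_consts w c); rewrite return_add return_coboundary return_const.
have [q [q_monic size_q q_le qBL q_root]] := quotient_charpoly ZN BN return_mx_colsum.
(* Cocycles have dimension at most [n + d] and coboundaries at least [n - 1]. *)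
have rankD : (\rank (Z :\: BL rat)%MS <= d.+1)%N.
  have arith z b k c e m' : (k <= b -> n <= k.+1 -> n <= c + e ->
      b + z = m' - c -> m' = 2 * n -> z <= e.+1)%N by lia.
  have := mxrank_cap_compl Z (BL rat); rewrite (capmx_idPr sBZ) mxrank_ker => rZ.
  apply: arith (rank_coboundary_mx conn rat) (rank_curvature_mx conn rat d_gt0) rZ _.
    by rewrite mxrankS // /BL -addsmxE addsmxSl.
  by rewrite card_prod card_bool card_ord.
exists q; split=> //.
- by rewrite size_q.
- by move=> k; rewrite (leq_trans (q_le k)) // leq_pexp2l.
- move=> f /sub_cocycleP /qBL.
  have -> : row_of f *m poly_mx (map_poly intr q) (map_mx intr return_mx) =
     row_of (fun x i => \sum_(k < size q) (q`_k)%:~R * iter k (@return_map rat) f x i).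
    apply/rowP => e; rewrite /poly_mx mulmx_sumr summxE mxE.
    rewrite size_map_inj_poly //; last exact: intr_inj.
    apply: eq_bigr => k _; rewrite coef_map /= -scalemxAr -row_of_iter_return.
    by rewrite !mxE.
  move=> /sub_exact_constP [u [c fE]]; exists u, c => x i.
  by have := congr1 (fun F => F x i) fE.
move=> K lambda /q_root [y [_ yBL yN]].
have BLK : map_mx ratr (BL rat) =
  BL K by rewrite map_col_mx map_coboundary_mx map_constant_cochain_mx.
rewrite BLK in yBL yN; exists (coch_of y); split.
  move=> u c yE; case/negP: yBL; rewrite -[y](@coch_ofK n) yE.
  by apply/sub_exact_constP; exists u, c.
move: yN; rewrite -{1}[y](@coch_ofK n) -row_of_return -[X in (X <= _)%MS](@coch_ofK n).
move=> /sub_exact_constP [u [c E]]; exists u, c => x i.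
have := congr1 (fun F => F x i) E; rewrite {1}/coch_of !mxE enum_rankK /= => e.
by rewrite -addrA -e addrC subrK.
Qed.
End Return.

(** * Simplicity of the Perron root *)

(** The edge [b] of [pos_step b P] is the path [~~ b], [b] of [P]. Iterating this substitution along
    [w] writes each new edge as a path of old ones. *)
Definition sub_letter b x : seq bool := if x == b then [:: ~~ b; b] else [:: x].

Definition sub_word b (u : seq bool) : seq bool := flatten [seq sub_letter b x | x <- u].

Definition sub_words w u : seq bool := foldr sub_word u w.

Lemma sub_word_cat b u v : sub_word b (u ++ v) = sub_word b u ++ sub_word b v.
Proof. by rewrite /sub_word map_cat flatten_cat. Qed.

Lemma sub_words_cat w u v : sub_words w (u ++ v) = sub_words w u ++ sub_words w v.
Proof. by elim: w => //= b w ->; rewrite sub_word_cat. Qed.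

Lemma mem_sub_word b x u : x \in u -> x \in sub_word b u.
Proof.
move=> xu; apply/flatten_mapP; exists x => //.
by rewrite /sub_letter; case: eqP => [->|]; rewrite !inE eqxx ?orbT.
Qed.

Lemma mem_sub_words w x u : x \in u -> x \in sub_words w u.
Proof. by move=> xu; elim: w => //= b w; apply: mem_sub_word. Qed.

Lemma sub_word_cons b x u : exists v, sub_word b (x :: u) = ~~ b :: v.
Proof. by rewrite /sub_word /= /sub_letter; case: x b => -[] /=; eexists. Qed.

Section Paths.
Variables (n : nat).

Fixpoint path_sum (K : nmodType) P (f : bool -> 'I_n -> K) i u : K :=
  if u is x :: u' then f x i + path_sum P f ((P : bool -> 'S_n) x i) u' else 0.

Definition path_end (P : bool -> 'S_n) i u := foldl (fun j x => P x j) i u.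

Lemma path_sum_cat (K : nmodType) P (f : bool -> 'I_n -> K) i u v :
  path_sum P f i (u ++ v) = path_sum P f i u + path_sum P f (path_end P i u) v.
Proof. by elim: u i => [|x u IH] i /=; rewrite ?add0r // IH addrA. Qed.

Lemma path_sum_step (K : nmodType) b P (f : bool -> 'I_n -> K) i u :
  path_sum (pos_step b P) (step_cochain b P f) i u = path_sum P f i (sub_word b u).
Proof.
elim: u i => //= x u IH i; rewrite IH /sub_word /= path_sum_cat.
congr (_ + path_sum _ _ _ _).
  by rewrite /step_cochain /sub_letter; case: ifP => _ //=; rewrite ?addr0.
by rewrite /pos_step /sub_letter; case: ifP => _ //=; rewrite permM.
Qed.

Lemma pull_path (K : nmodType) w P (f : bool -> 'I_n -> K) x i :
  pull w P f x i = path_sum P f i (sub_words w [:: x]).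
Proof.
elim: w P f => [|b w IH] P f /=; first by rewrite addr0.
by rewrite IH path_sum_step.
Qed.

Lemma path_sum_ge0 (K : numDomainType) P (f : bool -> 'I_n -> K) i u :
  (forall x j, 0 <= f x j) -> 0 <= path_sum P f i u.
Proof. by move=> f0; elim: u i => //= x u IH i; rewrite addr_ge0. Qed.

Lemma path_sum_eq0 (K : numDomainType) P (f : bool -> 'I_n -> K) i u x v :
  (forall y j, 0 <= f y j) -> path_sum P f i (u ++ x :: v) = 0 ->
  f x (path_end P i u) = 0.
Proof.
move=> f0; rewrite path_sum_cat /= => /eqP.
by rewrite !paddr_eq0 ?addr_ge0 ?path_sum_ge0 // => /and3P [_ /eqP].
Qed.

Lemma path_end_inj P u : injective (fun i => path_end P i u).
Proof. by elim: u => [|x u IH] i j //= /IH /perm_inj. Qed.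

Lemma inj_stable_onto (s : 'I_n -> 'I_n) (R : {set 'I_n}) : injective s ->
  (forall i, i \in R -> s i \in R) -> forall j, j \in R -> exists2 i, i \in R & j = s i.
Proof.
move=> inj_s sR j; have : s @: R == R.
  by rewrite eqEcard card_imset // leqnn andbT; apply/subsetP => _ /imsetP [i /sR iR ->].
by move=> /eqP {1}<- /imsetP.
Qed.
End Paths.

Section Perron.
Variables (n : nat) (P : bool -> 'S_n) (b : bool) (w' : seq bool) (g : 'S_n).
Let w := b :: rcons w' (~~ b).
Hypothesis conn : forall S : {set 'I_n}, (exists i, i \in S) ->
  (forall x i, i \in S -> P x i \in S) -> S = setT.

(** The last letter of [w] acts first and turns [~~ b] into [b] followed by [~~ b]; the later
    substitutions keep an occurrence of each letter in the image of either one. *)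
Lemma sub_wordsE : exists u v, sub_words w [:: ~~ b] = u ++ b :: v /\ v != [::].
Proof.
rewrite /w -cats1 /= /sub_words foldr_cat /= /sub_word /= /sub_letter eqxx negbK cats0.
rewrite -/(sub_letter b) -/(sub_words w' _) -[flatten _]/(sub_word b _).
rewrite -[[:: b; ~~ b]]/([:: b] ++ [:: ~~ b]) sub_words_cat sub_word_cat.
have : b \in sub_word b (sub_words w' [:: b]).
  by rewrite mem_sub_word // mem_sub_words // inE.
case/splitPr => u v; exists u, (v ++ sub_word b (sub_words w' [:: ~~ b])).
split; first by rewrite -catA.
have : ~~ b \in sub_word b (sub_words w' [:: ~~ b]).
  by rewrite mem_sub_word // mem_sub_words // inE.
by case: (sub_word b _) v => // a l [].
Qed.

Lemma sub_words_head x : exists v, sub_words w [:: x] = ~~ b :: v.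
Proof.
rewrite /w /=; have : x \in sub_words (rcons w' (~~ b)) [:: x].
  by rewrite mem_sub_words // inE.
by case: (sub_words _ _) => // y u _; apply: sub_word_cons.
Qed.

(* With [g]-invariance, the zeros of [y] propagate along the paths [sub_words w [:: x]].
   All of them start with the letter [~~ b], and one of them crosses [b] before its end. *)
Lemma zero_propagation (K : numDomainType) (lambda : K) (y : bool -> 'I_n -> K) :
  (forall x i, 0 <= y x i) -> (forall x i, return_map P w g y x i = lambda * y x i) ->
  (exists x i, y x i = 0) -> forall x i, y x i = 0.
Proof.
move=> y0 yE yz; pose R := [set i | [exists x, y x i == 0]].
have path0 x i : y x i = 0 -> path_sum P y (g i) (sub_words w [:: x]) = 0.
  by move=> yxi; rewrite -pull_path -[LHS]/(return_map P w g y x i) yE yxi mulr0.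
have inR x i : y x i = 0 -> i \in R by move=> yxi; rewrite inE; apply/existsP; exists x;
  apply/eqP.
have first0 x i : y x i = 0 -> y (~~ b) (g i) = 0.
  move=> /path0; have [v ->] := sub_words_head x.
  exact: (@path_sum_eq0 _ _ P y (g i) [::]).
have gR i : i \in R -> g i \in R.
  by rewrite inE => /existsP [x /eqP /first0 /inR].
(* Two applications of [g] are needed: the first turns a zero in an unknown direction into one in
   direction [~~ b], the second spreads it along the path of [~~ b]. *)
have R0 j : j \in R -> path_sum P y j (sub_words w [:: ~~ b]) = 0.
  move=> /(inj_stable_onto (@perm_inj _ g) gR) [i1 /(inj_stable_onto (@perm_inj _ g) gR) [i2
    + ->] ->].
  by rewrite inE => /existsP [x /eqP /first0 /path0].
have split0 j u x v : j \in R -> sub_words w [:: ~~ b] = u ++ x :: v ->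
    y x (path_end P j u) = 0.
  by move=> /R0 + wE; rewrite wE; apply: path_sum_eq0.
have next j u x v : j \in R -> sub_words w [:: ~~ b] = u ++ x :: v -> v != [::] ->
    P x (path_end P j u) \in R.
  case: v => // x' v jR wE _; rewrite (_ : P x _ = path_end P j (rcons u x)).
    by apply: (inR x'); apply: split0 jR _; rewrite wE cat_rcons.
  by rewrite /path_end foldl_rcons.
have [u [v [wE vn]]] := sub_wordsE; have [v' wE'] := sub_words_head (~~ b).
have PhR j : j \in R -> P (~~ b) j \in R.
  move=> jR; apply: (next j [::] (~~ b) v' jR wE').
  have : b \in sub_words w [:: ~~ b] by rewrite wE mem_cat inE eqxx orbT.
  by rewrite wE' inE; case: (v') => //; rewrite orbF; case: (b).
(* Following [u] maps [R] injectively into itself, so every square of [R] is the end of such a path,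
   and the letter [b] that comes next can be read from any of them. *)
have onto : forall k, k \in R -> exists2 j, j \in R & k = path_end P j u.
  apply: inj_stable_onto; first exact: path_end_inj.
  by move=> j jR; apply: (inR b); apply: split0 jR wE.
have PvR k : k \in R -> P b k \in R.
  by move=> /onto [j jR ->]; apply: next jR wE vn.
have RT : R = setT.
  apply: conn; first by case: yz => x [i /inR iR]; exists i.
  by move=> x i iR; have [->|xb] := eqVneq x b; [apply: PvR | rewrite (_ : x = ~~ b);
    [apply: PhR | case: (x) (b) xb => -[]]].
move=> x i; have iR : i \in R by rewrite RT.
have [->|xb] := eqVneq x b; first by have [j jR ->] := onto i iR; apply: split0 jR wE.
rewrite (_ : x = ~~ b); first exact: (split0 i [::] (~~ b) v').
by case: (x) (b) xb => -[].
Qed.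

(** On basis vectors this says that the four entries of the matrix of [w] are at least 1, because
    both letters occur in [w]. *)
Lemma pull_consts_ge (K : numDomainType) (c : bool -> K) : (forall x, 0 <= c x) ->
  forall x, c true + c false <= pull_consts w c x.
Proof.
move=> c0.
have mono w1 (c1 : bool -> K) : (forall x, 0 <= c1 x) -> forall x, c1 x <= pull_consts w1 c1 x.
  elim: w1 c1 => [|b1 w1 IH] c1 c10 x //=.
  have s0 y : 0 <= step_const b1 c1 y by rewrite /step_const; case: ifP; rewrite ?addr_ge0.
  apply: le_trans (IH _ s0 x); rewrite /step_const; case: ifP => // /eqP ->.
  by rewrite lerDr.
have pull_consts_rcons w1 b1 (c1 : bool -> K) : pull_consts (rcons w1 b1) c1 =
  step_const b1 (pull_consts w1 c1).
  by elim: w1 c1 => //= b2 w1 IH c1; rewrite IH.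
have s0 y : 0 <= step_const b c y by rewrite /step_const; case: ifP; rewrite ?addr_ge0.
have le1 := mono w' _ s0.
have h1 : c true + c false <= pull_consts w' (step_const b c) b.
  by apply: le_trans (le1 b); rewrite /step_const eqxx; case: (b); rewrite //= addrC.
move=> x; rewrite /w /= pull_consts_rcons {1}/step_const; case: eqP => [_|xb].
  by rewrite negbK (le_trans h1) // lerDl (le_trans (s0 _) (le1 _)).
by rewrite (_ : x = b) //; case: (x) (b) xb => -[].
Qed.
End Perron.

Lemma pull_consts_lin (K : comNzRingType) w (k : K) (c c' : bool -> K) :
  pull_consts w (fun x => k * c x + c' x) = fun x => k * pull_consts w c x + pull_consts w c' x.
Proof.
elim: w c c' => //= b w IH c c'; apply: etrans _ (IH _ _); congr (pull_consts w _).
by apply/funext => x; rewrite /step_const; case: ifP => // _; ring.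
Qed.

Lemma pull_consts_delta (K : comNzRingType) w (c : bool -> K) x :
  pull_consts w c x = c true * pull_consts w (fun y => (y == true)%:R) x
              + c false * pull_consts w (fun y => (y == false)%:R) x.
Proof.
have -> : c = fun y => c true * (y == true)%:R + (c false * (y == false)%:R + 0).
  by apply/funext => -[]; rewrite ?eqxx /=; ring.
rewrite pull_consts_lin (pull_consts_lin _ _ _ (fun _ => 0)).
have -> : pull_consts w (fun _ => 0 : K) = fun _ => 0.
  by elim: w => //= b w {2}<-; congr (pull_consts w _); apply/funext => y;
    rewrite /step_const addr0 if_same.
by rewrite /= ?eqxx; ring.
Qed.

Lemma pull_consts_scale (K : comNzRingType) w (k : K) (c : bool -> K) x :
  pull_consts w (fun x => k * c x) x = k * pull_consts w c x.
Proof. by rewrite (pull_consts_delta w (fun y => k * c y)) (pull_consts_delta w c); ring. Qed.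

(** The solution is the geometric series of the terms lambda^(-j-1) u(g^j i), folded to one period
    of [g]. *)
Lemma solve_cohomological (K : fieldType) n (g : 'S_n) (lambda : K) (u : 'I_n -> K) :
  lambda != 0 -> lambda ^+ #[g]%g != 1 ->
  exists v : 'I_n -> K, forall i, lambda * v i - v (g i) = u i.
Proof.
move=> l0 l1; pose k := #[g]%g.
pose s i := \sum_(j < k) lambda ^- j.+1 * u ((g ^+ j)%g i).
exists (fun i => (1 - lambda ^- k)^-1 * s i) => i.
have shift : lambda * s i - s (g i) = (1 - lambda ^- k) * u i.
  rewrite /s mulr_sumr.
  under eq_bigr do rewrite mulrA exprS invfM mulrA mulfV // mul1r.
  under [X in _ - X]eq_bigr do rewrite -permM -expgS.
  pose f j := - (lambda ^- j * u ((g ^+ j)%g i)).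
  rewrite -sumrB (eq_bigr (fun j : 'I_k => f j.+1 - f j)); last first.
    by move=> j _; rewrite /f opprK addrC.
  rewrite -(big_mkord xpredT (fun j => f j.+1 - f j)) telescope_sumr // /f.
  by rewrite expg_order expg0 perm1 expr0 invr1; ring.
rewrite mulrCA -mulrBr shift mulKf // subr_eq0 eq_sym.
by rewrite -[X in _ != X]invr1 (inj_eq invr_inj).
Qed.

Section PerronRoot.
Variables (n : nat) (P : bool -> 'S_n) (b : bool) (w' : seq bool) (g : 'S_n).
Let w := b :: rcons w' (~~ b).
Hypothesis Pg : forall x, pos_act w P x = (P x ^ g)%g.
Hypothesis conn : forall S : {set 'I_n}, (exists i, i \in S) ->
  (forall x i, i \in S -> P x i \in S) -> S = setT.
Variable K : rcfType.

(** By Cayley-Hamilton the 2x2 matrix M of [w] satisfies (M - lambda)(M - mu) = 0, so the image of M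
    - mu lies in the eigenline of [c]. This last clause later makes a constant error term
    proportional to [c]. *)
Lemma perron_root : exists (lambda mu : K) (c : bool -> K),
  [/\ 1 < lambda, forall x, 0 < c x, mu < lambda,
      forall x, pull_consts w c x = lambda * c x
    & forall l, exists k, forall x, pull_consts w l x - mu * l x = k * c x].
Proof.
pose a x y : K := pull_consts w (fun z => (z == y)%:R) x.
have a1 x y : 1 <= a x y.
  have := @pull_consts_ge b w' K (fun z => (z == y)%:R) _ x.
  by case: y => /= ge; (apply: le_trans (ge _); last by case); rewrite ?addr0 ?add0r.
have aE c x : pull_consts w c x = c true * a x true + c false * a x false :=
  pull_consts_delta _ _ _.
move: (a1 true true) (a1 true false) (a1 false true) (a1 false false).
set A := a true true in aE *; set B := a true false; set C := a false true; set D :=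
  a false false.
move=> A1 B1 C1 D1.
have aEt c : pull_consts w c true = c true * A + c false * B by rewrite aE.
have aEf c : pull_consts w c false = c true * C + c false * D by rewrite aE.
(* The discriminant of the characteristic polynomial. *)
pose delta := (A - D) ^+ 2 + 4 * (B * C).
have BC1 : 1 <= B * C by rewrite -[1]mulr1 ler_pM.
have delta_ge : (A - D) ^+ 2 + 4 <= delta by rewrite lerD2l; lra.
pose s := Num.sqrt delta.
have s2 : s ^+ 2 = delta by rewrite sqr_sqrtr // (le_trans _ delta_ge) // addr_ge0 ?sqr_ge0.
have s0 : 0 <= s by apply: sqrtr_ge0.
have s_gt2 : 2 <= s.
  rewrite -(ler_pXn2r (n := 2)) ?nnegrE // s2 (le_trans _ delta_ge) //.
  by have := sqr_ge0 (A - D); rewrite -natrX /=; lra.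
have s_gt : `|A - D| < s.
  rewrite -(ltr_pXn2r (n := 2)) ?nnegrE // s2 real_normK ?num_real //.
  by apply: lt_le_trans delta_ge; rewrite ltrDl.
move: s_gt; rewrite ltr_norml => /andP [sl sr].
exists ((A + D + s) / 2), ((A + D - s) / 2), (fun x => if x then B else (D - A + s) / 2).
have BC : (D - A + s) * (A - D + s) = 4 * (B * C).
  by transitivity (s ^+ 2 - (A - D) ^+ 2); [ring | rewrite s2 /delta; ring].
split.
- lra.
- by case; lra.
- lra.
- by case; rewrite ?aEt ?aEf; [field | move: BC; nra].
move=> l; exists (l true * ((A - D + s) / 2) / B + l false); case.
  rewrite aEt; field; lra.
rewrite aEf (_ : C = (D - A + s) * (A - D + s) / (4 * B)); first by field; lra.
by rewrite BC; field; lra.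
Qed.

(** A maximum principle: after removal of the exact term, the ratio of the cochain to the Perron
    vector is compared with its extreme values. Positivity of the action then excludes a Jordan
    block, and propagation of zeros makes the ratio constant. *)
Lemma perron_simple : exists lambda : K, (exists2 c : bool -> K, forall x, 0 < c x &
    forall x, pull_consts w c x = lambda * c x) /\
  forall (y : bool -> 'I_n -> K) u c,
    (forall x i, return_map P w g y x i = lambda * y x i + coboundary P u x i + c x) ->
    exists u' c', y = fun x i => coboundary P u' x i + c' x.
Proof.
have [lambda [mu [c [l1 c0 ml cE resolvent]]]] := perron_root.
exists lambda; split; first by exists c.
move=> y u c1 yE.
(* Adding the coboundary of [v] to [y] will absorb the exact term. *)
have [v vE] : exists v : 'I_n -> K, forall i, lambda * v i - v (g i) = u i.
  apply: solve_cohomological; first by rewrite gt_eqF // (lt_trans ltr01).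
  by rewrite gt_eqF // exprn_egt1 // -lt0n order_gt0.
pose y1 x i := y x i + coboundary P v x i.
have y1E x i : return_map P w g y1 x i = lambda * y1 x i + c1 x.
  rewrite return_add return_coboundary // yE /y1 /coboundary /= -!vE; ring.
have [k kE] := resolvent c1.
(* This combination turns the error [c1] into [k * c]. *)
pose y2 x i := (lambda - mu) * y1 x i + c1 x.
have y2E x i : return_map P w g y2 x i = lambda * y2 x i + k * c x.
  rewrite (return_add P w g (fun x i => (lambda - mu) * y1 x i) (fun x _ => c1 x)).
  rewrite return_scale return_const y1E -kE /y2; ring.
have [n0|n_gt0] := posnP n.
  exists (fun _ => 0), (fun _ => 0); apply/funext => x; apply/funext => -[i ilt].
  by exfalso; rewrite n0 in ilt.
pose e0 : bool * 'I_n := (true, Ordinal n_gt0).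
pose z (e : bool * 'I_n) := y2 e.1 e.2 / c e.1.
have zE x i : y2 x i = z (x, i) * c x by rewrite /z divfK // gt_eqF.
have retc (m : K) (q : K) x i : return_map P w g (fun x i => m * c x + q * y2 x i) x i =
    lambda * (m * c x + q * y2 x i) + q * k * c x.
  rewrite (return_add P w g (fun x i => m * c x) (fun x i => q * y2 x i)).
  rewrite (return_const P w g (fun x => m * c x)) return_scale y2E.
  by rewrite pull_consts_scale cE; ring.
case: (arg_maxP z (erefl true : xpredT e0)) => -[x1 i1] _ max_z.
case: (arg_minP z (erefl true : xpredT e0)) => -[x2 i2] _ min_z.
pose M := z (x1, i1); pose m := z (x2, i2).
have Y_ge0 x i : 0 <= M * c x + (- 1) * y2 x i.
  by rewrite mulN1r subr_ge0 zE ler_wpM2r ?(ltW (c0 x)) //; apply: max_z.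
have Y'_ge0 x i : 0 <= (- m) * c x + 1 * y2 x i.
  by rewrite mul1r mulNr addrC subr_ge0 zE ler_wpM2r ?(ltW (c0 x)) //; apply: min_z.
(* At the maximum of [z] the term in [lambda] vanishes, and a nonnegative cochain has a nonnegative
   image: only [- k * c] is left. The minimum gives the other sign. *)
have k_le0 : k <= 0.
  have := @pull_ge0 n K w P _ Y_ge0 x1 (g i1);
    rewrite -[pull _ _ _ _ _]/(return_map P w g _ _ _) retc.
  by rewrite zE mulN1r subrr mulr0 add0r mulN1r mulNr oppr_ge0 pmulr_lle0.
have k_ge0 : 0 <= k.
  have := @pull_ge0 n K w P _ Y'_ge0 x2 (g i2);
    rewrite -[pull _ _ _ _ _]/(return_map P w g _ _ _) retc.
  by rewrite zE mul1r mulNr addNr mulr0 add0r mul1r pmulr_lge0.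
have k0 : k = 0 by apply/eqP; rewrite eq_le k_le0.
have Y0 : forall x i, M * c x + (- 1) * y2 x i = 0.
  apply: (@zero_propagation n P b w' g conn K lambda (fun x i =>
    M * c x + (- 1) * y2 x i)) => //.
    by move=> x i; rewrite retc k0 mulr0 mul0r addr0.
  by exists x1, i1; rewrite zE mulN1r subrr.
exists (fun i => - v i), (fun x => (M * c x - c1 x) / (lambda - mu)).
apply/funext => x; apply/funext => i.
have lm : lambda - mu != 0 by rewrite subr_eq0 gt_eqF.
apply: (mulfI lm); have := Y0 x i; rewrite mulN1r => /eqP; rewrite subr_eq0 => /eqP.
rewrite /y2 /y1 => E; rewrite mulrDr mulrC (mulrC _ (_ / _)) divfK // E /coboundary; ring.
Qed.
End PerronRoot.

(** * Integrality and the bound on the number of squares *)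

(** Primitivity through equivalence relations. Forward invariance is enough, the inverse of a
    permutation of a finite set being one of its powers. *)
Definition block_trivial n (P : bool -> 'S_n) := forall E : rel 'I_n,
  equivalence_rel E -> (forall x i j, E i j -> E (P x i) (P x j)) ->
  (forall i j, E i j) \/ (forall i j, E i j -> i = j).

Section Integrality.
Variables (n : nat) (P : bool -> 'S_n).
Hypothesis primP : block_trivial P.
Hypothesis irrP : (0 < #|[set j | ~~ regular P j]|)%N.

Lemma irregular_exists : exists j, P true (P false j) <> P false (P true j).
Proof.
by move: irrP; rewrite card_gt0 => /set0Pn [j]; rewrite inE => /eqP; exists j.
Qed.

(* The classes of [v] modulo the integers are blocks. *)
Lemma periods_integral (v : 'I_n -> rat) (s : bool -> rat) :
  (forall x i, coboundary P v x i + s x \is a Num.int) -> forall x, s x \is a Num.int.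
Proof.
move=> vs; pose E : rel 'I_n := fun i j => v i - v j \is a Num.int.
have Eeq : equivalence_rel E.
  move=> i j k; rewrite /E subrr; split=> [|ij]; first exact: rpred0.
  by rewrite -[v i - v k](subrKA (v j)) rpredDl.
have EP x i j : E i j -> E (P x i) (P x j).
  rewrite /E => ij; have := rpredD (rpredB (vs x i) (vs x j)) ij.
  by congr (_ \is a Num.int); rewrite /coboundary; ring.
have [j jP] := irregular_exists.
case: (primP Eeq EP) => [Eall|Etriv] x.
  by have := rpredB (vs x j) (Eall (P x j) j); rewrite /coboundary addrC addKr.
(* The values of [v] at the ends of the two paths around an irregular corner differ by integral
   terms in which [s] cancels, so trivial blocks would close the corner up. *)
case: jP; apply: Etriv; rewrite /E.
have -> : v (P true (P false j)) - v (P false (P true j)) =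
    (coboundary P v true (P false j) + s true) + (coboundary P v false j + s false)
    - (coboundary P v false (P true j) + s false) - (coboundary P v true j + s true).
  by rewrite /coboundary; ring.
exact: rpredB (rpredB (rpredD (vs _ _) (vs _ _)) (vs _ _)) (vs _ _).
Qed.

Definition boundary (c : bool -> 'I_n -> int) (k : 'I_n) : int :=
  \sum_x (c x ((P x)^-1%g k) - c x k).

(* The cocycle Poincare dual to the 1-cycle [c]. *)
Definition dual_cocycle (c : bool -> 'I_n -> int) : bool -> 'I_n -> int :=
  fun x i => if x then c false ((P false)^-1%g i) else - c true ((P true)^-1%g i).

Lemma cocycle_dual c : (forall k, boundary c k = 0) -> cocycle P (dual_cocycle c).
Proof.
move=> c0 j _; rewrite /curvature /dual_cocycle !permK -[RHS]oppr0 -(c0 j) /boundary big_bool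
  /=; ring.
Qed.

Lemma sum_dual c x : \sum_i dual_cocycle c x i =
  if x then \sum_i c false i else - \sum_i c true i.
Proof.
case: x; rewrite /dual_cocycle ?sumrN.
  by rewrite [RHS](reindex_inj (@perm_inj _ (P false)^-1%g)).
by rewrite [in RHS](reindex_inj (@perm_inj _ (P true)^-1%g)).
Qed.

Lemma boundaryD c1 c2 k : boundary (fun x i => c1 x i + c2 x i) k =
  boundary c1 k + boundary c2 k.
Proof. by rewrite /boundary -big_split; apply: eq_bigr => x _ /=; ring. Qed.

Lemma boundaryN c k : boundary (fun x i => - c x i) k = - boundary c k.
Proof. by rewrite /boundary -sumrN; apply: eq_bigr => x _; ring. Qed.

Lemma boundary_delta x i k : boundary (edge_indicator int (x, i)) k =
  (k == P x i)%:R - (k == i)%:R.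
Proof.
have E y : edge_indicator int (x, i) y ((P y)^-1%g k) - edge_indicator int (x, i) y k =
    if y == x then (k == P x i)%:R - (k == i)%:R else 0.
  rewrite /edge_indicator !xpair_eqE; case: eqP => [->|] //=.
  by rewrite -(inj_eq (@perm_inj _ (P x)) _ i) permKV.
rewrite /boundary; under eq_bigr do rewrite E.
by rewrite -big_mkcond big_pred1_eq.
Qed.

Lemma sum_edge_indicator1 x i y : \sum_j edge_indicator int (x, i : 'I_n) y j = (y == x)%:R.
Proof.
rewrite /edge_indicator; case: (eqVneq y x) => [->|yx].
  by rewrite (bigD1 i) //= eqxx big1 ?addr0 // => j ji; rewrite xpair_eqE (negPf ji) andbF.
by rewrite big1 // => j _; rewrite xpair_eqE (negPf yx).
Qed.

(* The blocks are the classes for the existence of a chain from [i] to [j] on which the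
   form [s true dx - s false dy] has an integral period. *)
Lemma cocycle_sums_integral (s : bool -> rat) :
  (forall f : bool -> 'I_n -> int, cocycle P f ->
     \sum_x s x * (\sum_i f x i)%:~R \is a Num.int) ->
  forall x, s x \is a Num.int.
Proof.
move=> sP; pose phi (c : bool -> 'I_n -> int) : rat :=
  s true * (\sum_i c false i)%:~R - s false * (\sum_i c true i)%:~R.
have phi_cycle c : (forall k, boundary c k = 0) -> phi c \is a Num.int.
  move=> /cocycle_dual /sP; rewrite big_bool !sum_dual /= rmorphN mulrN.
  by [].
have phiD c1 c2 : phi (fun x i => c1 x i + c2 x i) = phi c1 + phi c2.
  by rewrite /phi !big_split /= !rmorphD /=; ring.
have phiN c : phi (fun x i => - c x i) = - phi c.
  by rewrite /phi !sumrN !rmorphN /=; ring.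
have phi_delta x i : phi (edge_indicator int (x, i)) = if x then - s false else s true.
  by rewrite /phi !sum_edge_indicator1; case: x => /=; rewrite ?rmorph0 ?rmorph1; ring.
pose link c i j := (forall k, boundary c k = (k == j)%:R - (k == i)%:R) /\ phi c \is a Num.int.
pose E : rel 'I_n := fun i j => `[< exists c, link c i j >].
have Esym i j : E i j -> E j i.
  move=> /asboolP [c [bc pc]]; apply/asboolP; exists (fun x k => - c x k); split.
    by move=> k; rewrite boundaryN bc; ring.
  by rewrite phiN rpredN.
have Etrans i j k : E i j -> E j k -> E i k.
  move=> /asboolP [c [bc pc]] /asboolP [c' [bc' pc']]; apply/asboolP.
  exists (fun x l => c x l + c' x l); split; last by rewrite phiD rpredD.
  by move=> l; rewrite boundaryD bc bc'; ring.
have Eeq : equivalence_rel E.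
  move=> i j k; split=> [|ij].
    apply/asboolP; exists (fun _ _ => 0); split.
      by move=> l; rewrite /boundary big1 ?subrr // => x _; rewrite subrr.
    by rewrite /phi !big1 // !mulr0 subrr rpred0.
  by apply/idP/idP; apply: Etrans => //; apply: Esym.
have EP x i j : E i j -> E (P x i) (P x j).
  move=> /asboolP [c [bc pc]]; apply/asboolP.
  exists (fun y k => c y k + (edge_indicator int (x, j) y k + - edge_indicator int (x, i) y k)).
  split; first by move=> k; rewrite boundaryD boundaryD boundaryN bc !boundary_delta; ring.
  by rewrite phiD phiD phiN !phi_delta subrr addr0.
have [j jP] := irregular_exists.
case: (primP Eeq EP) => [Eall|Etriv] x.
  (* The chain linking [j] to its neighbour, minus the edge between them, is a cycle; hence this
     edge has an integral period. An edge in direction [~~ x] has period [s x] up to sign. *)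
  have /asboolP [c [bc pc]] := Eall j (P (~~ x) j).
  have /phi_cycle : forall k, boundary (fun y l =>
    c y l + - edge_indicator int (~~ x, j) y l) k = 0.
    by move=> k; rewrite boundaryD boundaryN bc boundary_delta subrr.
  rewrite phiD phiN phi_delta rpredDl // rpredN.
  by case: (x) => //=; rewrite rpredN.
(* The two paths around the irregular corner, one reversed, form a chain of period zero between
   their ends. *)
case: jP; apply: Etriv; apply/asboolP.
exists (fun y k => (- edge_indicator int (true, P false j) y k + - edge_indicator int (false,
  j) y k) +
  (edge_indicator int (true, j) y k + edge_indicator int (false, P true j) y k)); split.
  by move=> k; rewrite !boundaryD !boundaryN !boundary_delta; ring.
by rewrite !phiD !phiN !phi_delta (_ : _ + _ = 0) ?rpred0 //; ring.
Qed.
End Integrality.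

Lemma pull_consts_cat (K : nmodType) w1 w2 (c : bool -> K) : pull_consts (w1 ++ w2) c =
  pull_consts w2 (pull_consts w1 c).
Proof. by elim: w1 c => //= b w IH c; rewrite IH. Qed.

Definition power (w : seq bool) k := flatten (nseq k w).

Lemma iter_pull_consts (K : nmodType) w k (c : bool -> K) : iter k (pull_consts w) c =
  pull_consts (power w k) c.
Proof. by elim: k c => // k IH c; rewrite iterSr IH /power /= pull_consts_cat. Qed.

Lemma sum_iter_pull_consts (F : numDomainType) (q : {poly int}) w (s : bool -> F) x :
  \sum_(k < size q) (q`_k)%:~R * iter k (pull_consts w) s x =
  \sum_y (\sum_(k < size q) q`_k * iter k (pull_consts w) (fun z => (z == y)%:R) x)%:~R * s y.
Proof.
rewrite big_bool /= !rmorph_sum /= !mulr_suml -big_split /=.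
apply: eq_bigr => k _; rewrite !iter_pull_consts pull_consts_delta !rmorphM /=.
have de y : pull_consts (power w k) (fun z => (z == y)%:R) x =
    (pull_consts (power w k) (fun z => (z == y)%:R : int) x)%:~R :> F.
  rewrite -[RHS](congr1 (fun G => G x) (pull_consts_map (intr : {additive int -> F}) _ _)).
  by congr (pull_consts _ _ x); apply/funext => z; case: eqP.
by rewrite !de; ring.
Qed.

(** * Bounding the number of squares of an origami fixed by a mixed word *)

Section Bound.
Variables (n : nat) (P : bool -> 'S_n) (b : bool) (w' : seq bool) (g : 'S_n) (K : rcfType).
Let w := b :: rcons w' (~~ b).
Hypothesis Pg : forall x, pos_act w P x = (P x ^ g)%g.
Hypothesis conn : forall S : {set 'I_n}, (exists i, i \in S) ->
  (forall x i, i \in S -> P x i \in S) -> S = setT.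
Hypothesis primP : block_trivial P.
Local Notation d := #|[set j | ~~ regular P j]|.
Hypothesis d_gt0 : (0 < d)%N.

(** A nonzero entry of q(A) is a multiple of [n]. It has at most [d.+2] terms, each the product of a
    coefficient of [q], bounded through its roots, and an entry of a power of A, which doubles at
    most once per letter. *)
Lemma number_of_squares_bound : (n <= d.+2 * ((2 ^ size w).+1 ^ d.+1 * (2 ^ size w) ^ d.+2))%N.
Proof.
have [q [q_monic size_q q_le q_ret q_root]] := return_charpoly Pg conn d_gt0.
have [lambda [[c c_gt0 cE] simple]] := perron_simple Pg conn K.
(* A root would give an eigenclass that is not exact plus constant, against simplicity. *)
have q_lambda : (map_poly intr q).[lambda] != 0 :> K.
  apply/negP => /q_root [y [y_nex [u [c1 yE]]]].
  by have [u' [c' yE']] := simple y u c1 yE; apply: (y_nex u' c').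
pose delta y : bool -> int := fun x => (x == y)%:R.
(* [l] is the matrix q(A). *)
pose l x y : int := \sum_(k < size q) q`_k * iter k (pull_consts w) (delta y) x.
have lE (F : numDomainType) (s : bool -> F) x :
    \sum_(k < size q) (q`_k)%:~R * iter k (pull_consts w) s x = \sum_y (l x y)%:~R * s y.
  exact: sum_iter_pull_consts.
have ln x y : (n%:Z %| l x y)%Z.
  have n_gt0 : (0 < n)%N.
    by have [j _] := irregular_exists d_gt0; apply: leq_ltn_trans (ltn_ord j).
  have nQ : n%:R != 0 :> rat by rewrite pnatr_eq0 -lt0n.
  suff /(_ y) /intrP [z lz] : forall y, (l x y)%:~R / n%:R \is a (Num.int : qualifier 1 rat).
    apply/dvdzP; exists z; apply: (@intr_inj rat).
    by rewrite rmorphM /= -lz -[n%:Z%:~R]pmulrn divfK.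
  apply: (cocycle_sums_integral primP d_gt0 (s := fun y => (l x y)%:~R / n%:R)) => f fP.
  pose F : bool -> 'I_n -> rat := fun x i => (f x i)%:~R.
  have FP : cocycle P F.
    move=> j /fP /(congr1 (intr : int -> rat)); rewrite /curvature /F => e.
    by rewrite -[RHS]e !rmorphB rmorphD.
  have retF k : iter k (@return_map n P w g rat) F = fun x i =>
    (iter k (@return_map n P w g int) f x i)%:~R.
    by elim: k => //= k ->; rewrite (return_additive P w g (intr : {additive int -> rat})).
  have [u [c1 E]] := q_ret F FP.
  have c1_int : forall y, c1 y \is a Num.int.
    apply: (periods_integral primP d_gt0 (v := u)) => z i; rewrite -E.
    by apply: rpred_sum => k _; rewrite retF rpredM ?intr_int.
  have sum_iter k z : \sum_i iter k (@return_map n P w g rat) F z i =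
      iter k (pull_consts w) (fun z => \sum_i F z i) z.
    elim: k z => // k IH z; rewrite !iterS sum_return; congr (pull_consts w _ z).
    by apply/funext.
  suff <- : c1 x = \sum_y (l x y)%:~R / n%:R * (\sum_i f y i)%:~R by [].
  (* Summation over the squares kills the coboundary and multiplies the constant by [n]. *)
  have : n%:R * c1 x = \sum_y (l x y)%:~R * \sum_i F y i.
    rewrite -lE.
    under [RHS]eq_bigr do rewrite -sum_iter mulr_sumr.
    rewrite exchange_big /=; under [RHS]eq_bigr do rewrite E.
    rewrite big_split /= /coboundary sumrB [X in X - _](_ : _ = \sum_i u i); last first.
      by rewrite [RHS](reindex_inj (@perm_inj _ (P x))).
    rewrite subrr add0r.
    by rewrite sumr_const card_ord mulr_natl.
  move=> e; apply: (mulfI nQ); rewrite e mulr_sumr; apply: eq_bigr => y' _.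
  rewrite (_ : (\sum_i f y' i)%:~R = \sum_i F y' i); last by rewrite rmorph_sum.
  by move: (l x y')%:~R (\sum_i F y' i) => r r'; field.
have [x [y l0]] : exists x y, l x y != 0.
  (* The Perron vector [c] is an eigenvector of q(A) with eigenvalue q(lambda), so q(A) is
     nonzero. *)
  have : \sum_y (l true y)%:~R * c y != 0.
    rewrite -lE (_ : \sum_(k < _) _ = (map_poly intr q).[lambda] * c true).
      by rewrite mulf_neq0 // gt_eqF.
    rewrite horner_coef size_map_inj_poly //; last exact: intr_inj.
    rewrite mulr_suml; apply: eq_bigr => k _; rewrite coef_map -mulrA; congr (_ * _).
    suff -> : iter k (pull_consts w) c = fun x => lambda ^+ k * c x by [].
    elim: (k : nat) => [|j IH]; apply/funext => z; first by rewrite mul1r.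
    by rewrite iterS IH pull_consts_scale cE mulrA exprSr.
  move=> s0; case: (eqVneq (l true true) 0) => [lt|]; last by exists true, true.
  case: (eqVneq (l true false) 0) => [lf|]; last by exists true, false.
  by rewrite big_bool /= lt lf !mul0r addr0 eqxx in s0.
have : (n <= absz (l x y))%N.
  by apply: dvdn_leq; [rewrite absz_gt0 | have := ln x y; rewrite dvdzE].
move=> /leq_trans; apply.
rewrite -lez_nat; apply: le_trans (_ : \sum_(k < size q) `|q`_k| * `|iter k (pull_consts w)
  (delta y) x| <= _).
  by rewrite abszE (le_trans (ler_norm_sum _ _ _)) // ler_sum // => k _; rewrite normrM.
apply: le_trans (_ : \sum_(k < size q) ((2 ^ size w).+1 ^ d.+1 * (2 ^ size w) ^ d.+2)%N%:Z <=
  _).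
  apply: ler_sum => k _; rewrite PoszM ler_pM //; first by rewrite -abszE lez_nat.
  rewrite iter_pull_consts (le_trans (pull_consts_le (M := 1) _ _ _)) //.
    by rewrite /delta => z; case: eqP.
  rewrite mulr1 -natrX natz lez_nat (_ : size (power w k) = k * size w)%N.
    by rewrite mulnC expnM leq_pexp2l ?expn_gt0 // ltnW // (leq_trans (ltn_ord k)).
  by elim: (k : nat) => // j IH; rewrite /power /= size_cat IH.
rewrite sumr_const card_ord -mulr_natl -[X in X%:R * _]/(size q) natz -PoszM lez_nat.
by rewrite leq_mul2r size_q orbT.
Qed.
End Bound.

Local Close Scope ring_scope.
Local Open Scope group_scope.

(** * Orbits and fixed points *)

Definition letters n (q : hv_pair n) : bool -> 'S_n := fun x => if x then q.2 else q.1.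

(** The properties carried along a whole orbit; for a single zero of order k, [d] is k + 1. *)
Definition admissible n d (q : hv_pair n) : Prop :=
  [/\ block_trivial (letters q),
      forall S : {set 'I_n}, (exists i, i \in S) ->
        (forall x i, i \in S -> letters q x i \in S) -> S = setT
    & #|[set j | ~~ regular (letters q) j]| = d].

Section Primitive.
Variables (n : nat) (q : hv_pair n).
Hypothesis prim : primitive_origami q.

Lemma monodromy_stable (aT := 'S_n) (sT : finType) (to : {action 'S_n &-> sT}) (S : {set sT}) :
  (forall x a, a \in S -> to a (letters q x) \in S) -> [acts monodromy q, on S | to].
Proof.
move=> Sq; rewrite gen_subG; apply/subsetP => z; rewrite !inE.
by case/orP => /eqP ->; apply/subsetP => a aS; rewrite inE;
  [apply: (Sq false) | apply: (Sq true)].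
Qed.

Lemma primitive_conn (S : {set 'I_n}) : (exists i, i \in S) ->
  (forall x i, i \in S -> letters q x i \in S) -> S = setT.
Proof.
move=> [i iS] Sq; apply/setP => j; rewrite inE.
have /andP [tr _] := prim.
have [a aG ->] := atransP2 tr (in_setT i) (in_setT j).
by rewrite (actsP (@monodromy_stable _ 'P%act S Sq)).
Qed.

Lemma primitive_block_trivial : block_trivial (letters q).
Proof.
move=> E Eeq EP; pose Q := equivalence_partition E [set: 'I_n].
have Erefl i : E i i by case: (Eeq i i i).
have Elr i j k : E i j -> E i k = E j k by case: (Eeq i j k) => _; apply.
have EPV x i j : E (letters q x i) (letters q x j) -> E i j.
  move=> e; have EX k : E (((letters q x) ^+ k) (letters q x i)) (((letters q x) ^+ k)
    (letters q x j)).
    by elim: k => [|k IH]; rewrite ?expg0 ?perm1 // expgSr !permM; apply: EP.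
  have := EX #[letters q x].-1; rewrite -!permM -expgS prednK ?order_gt0 //.
  by rewrite expg_order !perm1.
have EE x i j : E (letters q x i) (letters q x j) = E i j.
  by apply/idP/idP; [apply: EPV | apply: EP].
have actsQ : [acts monodromy q, on Q | 'P^*].
  apply: monodromy_stable => x _ /imsetP [i _ ->].
  apply/imsetP; exists (letters q x i) => //; apply/setP => j; rewrite !inE /=.
  apply/imsetP/idP => [[k + ->]|e]; first by rewrite !inE /= apermE EE.
  exists ((letters q x)^-1 j); last by rewrite /= apermE permKV.
  by rewrite !inE -(EE x) permKV.
have partQ : partition Q [set: 'I_n].
  by apply: equivalence_partitionP => i j k _ _ _; apply: Eeq.
have /andP [_ /existsPn/(_ Q)] := prim.
rewrite /imprimitivity_system partQ actsQ /= negb_and -!leqNgt cardsT => /orP [Q1|Qn].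
  left=> i j; have cE := card_le1_eqP Q1 _ _ (imset_f _ (in_setT i)) (imset_f _ (in_setT j)).
  have /setP/(_ j) : [set y in [set: 'I_n] | E i y] = [set y in [set: 'I_n] | E j y].
    by apply/esym; exact: cE.
  by rewrite !inE /= Erefl.
right=> i j ij; have : #|Q| == #|[set: 'I_n]| by rewrite eqn_leq leq_imset_card cardsT Qn.
move=> /imset_injP; apply; rewrite ?inE //.
by apply/setP => k; rewrite !inE /=; apply: Elr.
Qed.
End Primitive.

Lemma regular_corner n (q : hv_pair n) j :
  regular (letters q) j = (corner_perm q (q.1 (q.2 j)) == q.1 (q.2 j)).
Proof. by rewrite /regular /corner_perm commgEl conjgE !permM !permK. Qed.

Lemma card_irregular n (q : hv_pair n) k : (0 < k)%N -> in_stratum q [:: k] ->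
  #|[set j | ~~ regular (letters q) j]| = k.+1.
Proof.
move=> k0; rewrite /in_stratum /zero_orders => /perm_small_eq -/(_ isT).
set s := [seq c <- _ | _] => sE.
have [c sc] : exists c, s = [:: c] by case: s sE => [|c []] //; exists c.
move: sE; rewrite sc => -[ck].
have : c \in s by rewrite sc inE.
rewrite mem_filter mem_enum => /andP [c1 cP].
have kc : k.+1 = #|c| by rewrite -ck prednK // ltnW.
rewrite kc -(card_imset [set j | _] (inj_comp (@perm_inj _ q.1) (@perm_inj _ q.2))).
apply: eq_card => i.
have -> : (i \in [set (q.1 \o q.2) j | j in [set j | ~~ regular (letters q) j]])
    = (corner_perm q i != i).
  apply/imsetP/idP => [[j + ->]|ci]; first by rewrite inE regular_corner.
  exists (q.2^-1 (q.1^-1 i)); last by rewrite /= !permKV.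
  by rewrite inE regular_corner !permKV.
have moved : (corner_perm q i != i) = (1 < #|porbit (corner_perm q) i|).
  apply/idP/idP => [ci|].
    rewrite (cardsD1 i) porbit_id (cardsD1 (corner_perm q i)) !inE ci /=.
    by rewrite -{1}[corner_perm q]expg1 mem_porbit.
  apply: contraTneq => ci; rewrite -leqNgt -(cards1 i) subset_leq_card //.
  by apply/subsetP => _ /porbitP [l ->]; rewrite inE; elim: l => [|l IH];
    rewrite ?expg0 ?perm1 // expgS permM ci.
rewrite moved; apply/idP/idP => [i1|ic].
  have : porbit (corner_perm q) i \in s by rewrite mem_filter i1 mem_enum imset_f.
  by rewrite sc inE => /eqP <-; apply: porbit_id.
move: cP c1 ic => /imsetP [l _ ->] c1; rewrite -eq_porbit_mem => /eqP ->; exact: c1.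
Qed.

Lemma admissible_of_stratum n k (q : hv_pair n) : (0 < k)%N -> primitive_origami q ->
  in_stratum q [:: k] -> admissible k.+1 q.
Proof.
move=> k0 pq sq; split; last exact: card_irregular.
  exact: primitive_block_trivial.
exact: primitive_conn.
Qed.

(** * Origamis up to simultaneous conjugation and sign *)

Section Classes.
Variable n : nat.
Implicit Types (q : hv_pair n) (g : 'S_n).

Definition conj_pair q g : hv_pair n := (q.1 ^ g, q.2 ^ g).
Definition inv_pair q : hv_pair n := (q.1^-1, q.2^-1).
Definition pstep b q : hv_pair n := if b then (q.1, q.1 * q.2) else (q.2 * q.1, q.2).
(* The inverse of [pstep b], namely T or S. *)
Definition punstep b q : hv_pair n := if b then T_pair q else S_pair q.
Definition pact w q := foldl (fun q b => pstep b q) q w.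

Lemma pstepK b : cancel (pstep b) (punstep b).
Proof. by case: b => -[h v]; rewrite /punstep /T_pair /S_pair /= mulKg. Qed.

Lemma punstepK b : cancel (punstep b) (pstep b).
Proof. by case: b => -[h v]; rewrite /punstep /T_pair /S_pair /= mulKVg. Qed.

Lemma letters_pstep b q : letters (pstep b q) = pos_step b (letters q).
Proof. by apply/funext => x; case: b x => -[]. Qed.

Lemma letters_pact w q : letters (pact w q) = pos_act w (letters q).
Proof. by elim: w q => //= b w IH q; rewrite IH letters_pstep. Qed.

(** A relation or set stable under [q] is stable under the products occurring in [pstep b q], so the
    conditions descend to [q]. As [punstep] inverts [pstep], they pass to the images under T and
    S. *)
Lemma admissible_pstep d b q : admissible d (pstep b q) -> admissible d q.
Proof.
rewrite /admissible letters_pstep => -[bt cn irr]; split.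
- move=> E Eeq EP; apply: bt => // x i j Eij; rewrite /pos_step.
  by case: ifP => _; rewrite ?permM; [apply/EP/EP | apply: EP].
- move=> S Sn SP; apply: cn => // x i iS; rewrite /pos_step.
  by case: ifP => _; rewrite ?permM; [apply/SP/SP | apply: SP].
rewrite -irr -(card_imset [set j | ~~ regular (pos_step b (letters q)) j] (@perm_inj _
  (letters q (~~ b)))).
apply: eq_card => i; apply/idP/imsetP => [|[j + ->]]; rewrite !inE.
  by move=> ri; exists ((letters q (~~ b))^-1 i); rewrite ?inE ?regular_step permKV.
by rewrite regular_step.
Qed.

Lemma admissible_punstep d b q : admissible d q -> admissible d (punstep b q).
Proof. by move=> gq; apply: (@admissible_pstep d b); rewrite punstepK. Qed.

Lemma conj_pairM q g g' : conj_pair (conj_pair q g) g' = conj_pair q (g * g').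
Proof. by rewrite /conj_pair /= !conjgM. Qed.

Lemma conj_pair1 q : conj_pair q 1 = q.
Proof. by case: q => h v; rewrite /conj_pair /= !conjg1. Qed.

Lemma inv_pairK : involutive inv_pair.
Proof. by case=> h v; rewrite /inv_pair /= !invgK. Qed.

Lemma conj_inv_pair q g : conj_pair (inv_pair q) g = inv_pair (conj_pair q g).
Proof. by rewrite /conj_pair /inv_pair /= !conjVg. Qed.

Lemma punstep_conj b q g : punstep b (conj_pair q g) = conj_pair (punstep b q) g.
Proof. by case: b; rewrite /punstep /T_pair /S_pair /conj_pair /= conjMg conjVg. Qed.

Lemma pstep_conj b q g : pstep b (conj_pair q g) = conj_pair (pstep b q) g.
Proof. by apply: (can_inj (punstepK b)); rewrite punstep_conj !pstepK. Qed.

Lemma pact_conj w q g : pact w (conj_pair q g) = conj_pair (pact w q) g.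
Proof. by elim: w q => //= b w IH q; rewrite pstep_conj IH. Qed.

(** This is the centrality of - 1 in SL(2, Z); on pairs it holds only up to conjugation. *)
Lemma punstep_inv b q : exists g, punstep b (inv_pair q) = conj_pair (inv_pair (punstep b q)) g.
Proof.
case: b; [exists (q.1^-1) | exists (q.2^-1)];
  by rewrite /punstep /T_pair /S_pair /conj_pair /inv_pair /= !conjgE !invMg !invgK !mulgA
     ?mulgK ?mulgV ?mulVg ?mul1g ?mulgKV.
Qed.

Lemma pstep_inv b q : exists g, pstep b (inv_pair q) = conj_pair (inv_pair (pstep b q)) g.
Proof.
have [g e] := punstep_inv b (pstep b q); exists g^-1.
apply: (can_inj (punstepK b)).
by rewrite pstepK punstep_conj e pstepK conj_pairM mulgV conj_pair1.
Qed.

Lemma pact_inv w q : exists g, pact w (inv_pair q) = conj_pair (inv_pair (pact w q)) g.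
Proof.
elim: w q => [|b w IH] q /=; first by exists 1; rewrite conj_pair1.
have [g ->] := pstep_inv b q; have [g' e] := IH (pstep b q).
by exists (g' * g); rewrite pact_conj e conj_pairM.
Qed.

Lemma origami_ofP q q' : reflect (exists g, q' = conj_pair q g) (q' \in origami_of q).
Proof. by apply: (iffP imsetP) => [[g _ ->]|[g ->]]; exists g. Qed.

Lemma origami_of_conj q g : origami_of (conj_pair q g) = origami_of q.
Proof.
apply/setP => q'; apply/origami_ofP/origami_ofP => -[g' ->].
  by exists (g * g'); rewrite conj_pairM.
by exists (g^-1 * g'); rewrite conj_pairM mulKVg.
Qed.

Lemma punstep_origami b q : punstep b @: origami_of q = origami_of (punstep b q).
Proof.
rewrite /origami_of -imset_comp; apply: eq_imset => g /=.
exact: punstep_conj.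
Qed.

(* Modulo - 1, which acts as [inv_pair], SL(2, Z) becomes Z/2 * Z/3. *)
Definition class_of q : {set hv_pair n} := origami_of q :|: origami_of (inv_pair q).

Lemma inv_origami q : inv_pair @: origami_of q = origami_of (inv_pair q).
Proof.
rewrite /origami_of -imset_comp; apply: eq_imset => g /=.
by rewrite /inv_pair /= !conjVg.
Qed.

Lemma punstep_class b q : punstep b @: class_of q = class_of (punstep b q).
Proof.
rewrite /class_of imsetU !punstep_origami.
by have [g ->] := punstep_inv b q; rewrite origami_of_conj.
Qed.

Lemma class_ofP q q' : class_of q = class_of q' ->
  exists g, q' = conj_pair q g \/ q' = conj_pair (inv_pair q) g.
Proof.
have : q' \in class_of q'.
  by rewrite inE; apply/orP; left; apply/origami_ofP; exists 1; rewrite conj_pair1.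
by move=> + e; rewrite -e inE => /orP [] /origami_ofP [g ->]; exists g; [left|right].
Qed.

Lemma class_of_conj q g : class_of (conj_pair q g) = class_of q.
Proof. by rewrite /class_of -conj_inv_pair !origami_of_conj. Qed.

Lemma class_of_inv q : class_of (inv_pair q) = class_of q.
Proof. by rewrite /class_of inv_pairK setUC. Qed.

Definition origami_class : finType := {A : {set hv_pair n} | [exists q, A == class_of q]}.

Lemma class_proof q : [exists q', class_of q == class_of q'].
Proof. by apply/existsP; exists q. Qed.

Definition to_class q : origami_class := 
  exist (fun A => [exists q, A == class_of q]) _ (class_proof q).

Lemma to_classP (c : origami_class) : exists q, c = to_class q.
Proof.
by case: c => A Ap; have /existsP [q /eqP Aq] := Ap; exists q; apply/val_inj.
Qed.

Lemma punstep_class_proof b (c : origami_class) :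
  [exists q, punstep b @: val c == class_of q].
Proof.
by have [q ->] := to_classP c; apply/existsP; exists (punstep b q); rewrite /= punstep_class.
Qed.

Definition punstep_fun b (c : origami_class) : origami_class :=
  exist (fun A => [exists q, A == class_of q]) _ (punstep_class_proof b c).

Lemma punstep_fun_inj b : injective (punstep_fun b).
Proof.
move=> c c' /(congr1 val) /=.
by move=> /(imset_inj (can_inj (punstepK b))) /val_inj.
Qed.

Definition unstep_perm b : {perm origami_class} := perm (@punstep_fun_inj b).

Lemma unstep_permE b q : unstep_perm b (to_class q) = to_class (punstep b q).
Proof. by rewrite permE; apply: val_inj; rewrite /= punstep_class. Qed.

Lemma step_permE b q : (unstep_perm b)^-1 (to_class q) = to_class (pstep b q).
Proof. by apply: (@perm_inj _ (unstep_perm b)); rewrite permKV unstep_permE pstepK. Qed.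

Local Notation t := (unstep_perm true).
Local Notation s := (unstep_perm false).

Definition rot_R : {perm origami_class} := t^-1 * s * t^-1.
Definition rot_U : {perm origami_class} := s^-1 * t.

Lemma perm_classP (x y : {perm origami_class}) :
  (forall q, x (to_class q) = y (to_class q)) -> x = y.
Proof. by move=> xy; apply/permP => c; have [q ->] := to_classP c. Qed.

Lemma to_class_conj_inv q q' g : q' = conj_pair (inv_pair q) g -> to_class q' = to_class q.
Proof. by move=> ->; apply: val_inj; rewrite /= class_of_conj class_of_inv. Qed.

(** The square of R and the cube of U are - 1, so both relations appear only on classes modulo
    sign. *)
Lemma rot_R2 : rot_R * rot_R = 1.
Proof.
apply: perm_classP => -[h v]; rewrite perm1 /rot_R !permM.
rewrite step_permE unstep_permE !step_permE unstep_permE step_permE.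
apply: (@to_class_conj_inv _ _ (h * v)).
rewrite /punstep /T_pair /S_pair /conj_pair /inv_pair /= !conjgE !invMg ?invgK.
by rewrite !mulgA !(mulgK, mulgKV, mulgV, mulVg, mul1g, mulg1).
Qed.

Lemma rot_U3 : rot_U * rot_U * rot_U = 1.
Proof.
apply: perm_classP => -[h v]; rewrite perm1 /rot_U !permM.
rewrite step_permE unstep_permE step_permE unstep_permE step_permE unstep_permE.
apply: (@to_class_conj_inv _ _ (v * h)).
rewrite /punstep /T_pair /S_pair /conj_pair /inv_pair /= !conjgE !invMg ?invgK.
by rewrite !mulgA !(mulgK, mulgKV, mulgV, mulVg, mul1g, mulg1).
Qed.

End Classes.

(* [(a, l, c)] stands for [r^a * \prod_(e <- l) (u^(+-1) * r) * u^c]. *)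
Definition normal_form := (bool * seq bool * option bool)%type.

(** Left multiplication by one letter. Since u^2 = u^-1, equal exponents merge into the opposite one
    and opposite exponents cancel, which may expose an [r]. *)
Definition nf_push (x : option bool) (f : normal_form) : normal_form :=
  match x, f with
  | None, (a, l, c) => (~~ a, l, c)
  | Some e, (true, l, c) => (false, e :: l, c)
  | Some e, (false, e' :: l, c) => if e == e' then (false, ~~ e :: l, c) else (true, l, c)
  | Some e, (false, [::], Some e') =>
    if e == e' then (false, [::], Some (~~ e)) else (false, [::], None)
  | Some e, (false, [::], None) => (false, [::], Some e)
  end.

Definition nf (w : seq (option bool)) : normal_form :=
  foldr nf_push (false, [::], None) w.

(** * Positive words and normal forms in the modular group *)

Section ModularGroup.
Variables (gT : finGroupType) (t s r u : gT).
Hypotheses (rE : r = t^-1 * s * t^-1) (uE : u = s^-1 * t).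
Hypotheses (rr : r * r = 1) (uuu : u * u * u = 1).

Definition letter_val (x : option bool) : gT :=
  match x with None => r | Some true => u | Some false => u^-1 end.
Definition word_val (w : seq (option bool)) : gT := \prod_(x <- w) letter_val x.
Definition pos_val (l : seq bool) : gT := \prod_(e <- l) (if e then t^-1 else s^-1).
Definition nf_val (f : normal_form) : gT :=
  (if f.1.1 then r else 1) * pos_val f.1.2 * (if f.2 is Some e then letter_val (Some e) else 1).

Lemma rV : r^-1 = r.
Proof. by apply/eqP; rewrite eq_invg_mul rr. Qed.
Lemma uu : u * u = u^-1.
Proof. by apply/eqP; rewrite eq_sym eq_invg_mul mulgA uuu. Qed.
Lemma uVuV : u^-1 * u^-1 = u.
Proof. by rewrite -invMg uu invgK. Qed.
(** This and [uVr] identify the blocks u^(+-1) r of a normal form with t^-1 and s^-1: the middle of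
    a normal form is a positive word. *)
Lemma ur : u * r = t^-1.
Proof. by rewrite uE rE !mulgA mulgK mulVg mul1g. Qed.
Lemma uVr : u^-1 * r = s^-1.
Proof.
have tE : t = r * u^-1 by rewrite -[t]invgK -ur invMg rV.
have sE : s = r * u.
  have : t * r * t = s by rewrite rE !mulgA mulgV mul1g mulgKV.
  by rewrite tE => <-; rewrite -!mulgA !(mulgA r r) rr mul1g uVuV.
by rewrite sE invMg rV.
Qed.

Lemma pos_val_cons e l : pos_val (e :: l) = letter_val (Some e) * r * pos_val l.
Proof. by rewrite /pos_val big_cons; case: e; rewrite /letter_val ?ur ?uVr. Qed.

Lemma pos_val_cat l1 l2 : pos_val (l1 ++ l2) = pos_val l1 * pos_val l2.
Proof. exact: big_cat. Qed.

Lemma pos_val_rcons l e : pos_val (rcons l e) = pos_val l * letter_val (Some e) * r.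
Proof. by rewrite -cats1 pos_val_cat pos_val_cons /pos_val big_nil mulg1 mulgA. Qed.

Lemma letter_val2 e e' : letter_val (Some e) * letter_val (Some e') =
  if e == e' then letter_val (Some (~~ e)) else 1.
Proof. by case: e e' => -[]; rewrite /= ?uu ?uVuV ?mulgV ?mulVg. Qed.

Lemma nf_val_push x f : nf_val (nf_push x f) = letter_val x * nf_val f.
Proof.
case: x f => [e|] [[[] l] c]; rewrite /nf_push /nf_val /=.
- by rewrite mul1g pos_val_cons !mulgA.
- case: l => [|e' l]; last first.
    move: (letter_val2 e e'); case: eqP => _ L2; rewrite /= !mul1g (pos_val_cons e') !mulgA L2.
      by rewrite pos_val_cons.
    by rewrite mul1g.
  by case: c => [e'|]; rewrite /pos_val big_nil !mul1g ?mulg1 // letter_val2; case: eqP;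
    rewrite /= ?mulg1 ?big_nil ?mul1g.
- by rewrite !mulgA rr !mul1g.
- by rewrite !mul1g mulgA.
Qed.

Lemma nf_val_nf w : nf_val (nf w) = word_val w.
Proof.
elim: w => [|x w IH]; rewrite /word_val ?big_nil ?big_cons.
  by rewrite /nf_val /pos_val big_nil !mulg1.
by rewrite [nf _]/= nf_val_push IH.
Qed.

(** Together with the next two lemmas, this is cyclic reduction: an outer [r] or u^(+-1) is carried
    to the other end, where it completes a block, cancels or merges. *)
Lemma nf_conj_both l e : nf_val (true, l, Some e) ^ r = pos_val (rcons l e).
Proof. by rewrite /nf_val pos_val_rcons conjgE /= !mulgA mulVg mul1g. Qed.

Lemma nf_conj_left l e : nf_val (true, rcons l e, None) ^ r = nf_val (false, l, Some e).
Proof.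
rewrite /nf_val pos_val_rcons conjgE /= mul1g mulg1 !mulgA mulVg mul1g.
by rewrite -(mulgA _ r r) rr mulg1.
Qed.

Lemma nf_conj_right l e e' : nf_val (false, e' :: l, Some e) ^ (letter_val (Some e))^-1 =
  if e == e' then pos_val (~~ e :: l) else nf_val (true, l, None).
Proof.
rewrite (_ : nf_val _ = pos_val (e' :: l) * letter_val (Some e)); last by rewrite /nf_val mul1g.
rewrite conjgE invgK pos_val_cons !mulgA mulgK letter_val2.
by case: eqP => _; rewrite ?pos_val_cons // mul1g /nf_val mulg1.
Qed.

Lemma pos_val_nseq b k : pos_val (nseq k b) = (if b then t else s) ^- k.
Proof.
elim: k => [|k IH]; first by rewrite /pos_val big_nil expg0 invg1.
by rewrite /= -cat1s pos_val_cat IH /pos_val big_seq1 expgSr invMg; case: b {IH}.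
Qed.

Lemma s_conj j : s ^+ j = r * t ^- j * r.
Proof.
have -> : s = t^-1 ^ r.
  by rewrite conjgE -ur rV !mulgA -(mulgA _ r r) rr mulg1 -[s]invgK -uVr invMg invgK rV.
by rewrite -conjXg conjgE rV expgVn mulgA.
Qed.

Lemma t_conj j : t ^+ j = r * s ^- j * r.
Proof.
rewrite s_conj !invMg rV invgK !mulgA rr mul1g -mulgA rr mulg1 //.
Qed.

Lemma rot_R_conj j : r * r ^ (t ^+ j) = s ^+ j * t ^+ j.
Proof. by rewrite conjgE s_conj !mulgA. Qed.

Lemma rot_U_conj j : u^-1 * u ^ (t ^+ j) = s ^+ j * t ^+ j.
Proof.
rewrite conjgE !mulgA; congr (_ * _).
have -> : s = t^-1 ^ u.
  by rewrite conjgE -ur !mulgA mulVg mul1g -[s]invgK -uVr invMg invgK rV.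
by rewrite -conjXg conjgE expgVn mulgA.
Qed.

(** The left side is conjugate to a commutator, with exponents of both signs. Conjugation by [r]
    exchanges powers of [t] with inverse powers of [s], and the stray [r] and [u] are absorbed by
    the neighbouring letters; only negative powers remain. *)
Lemma twist_conj k j :
  u * (t ^- k.+1 * (t ^+ k.+1) ^ (s ^+ j.+1)) * u^-1 =
  pos_val ([:: false] ++ nseq k true ++ nseq j false ++ [:: true] ++ nseq k false ++ nseq j
    true).
Proof.
have uT i : u * t ^- i.+1 = s^-1 * t ^- i.
  by rewrite expgSr invMg -ur !mulgA uu uVr.
rewrite !pos_val_cat !pos_val_nseq /pos_val !big_seq1 conjgE !mulgA uT -!mulgA.
congr (_ * (_ * _)); rewrite expgS invMg -!mulgA; congr (_ * _).
rewrite t_conj !mulgA -uVr -(mulgA _ r r) rr mulg1.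
have -> : u^-1 * s ^- k.+1 = t^-1 * s ^- k.
  by rewrite expgSr invMg -uVr !mulgA uVuV ur.
rewrite -!mulgA; congr (_ * (_ * _)).
rewrite !mulgA -(mulgA r s) -expgS s_conj expgS invMg -ur !mulgA rr mul1g.
by rewrite -(mulgA _ r r) rr mulg1 mulgK.
Qed.
End ModularGroup.

(** * Fixed points in an orbit *)

Section Orbit.
Variables (n : nat) (p : hv_pair n).
Local Notation V := (orbit_vertex p).

Lemma T_act_origami q : T_act n (origami_of q) = origami_of (punstep true q).
Proof. by rewrite permE -(punstep_origami true). Qed.

Lemma S_act_origami q : S_act n (origami_of q) = origami_of (punstep false q).
Proof. by rewrite permE -(punstep_origami false). Qed.

Lemma orbit_rep (Q : hv_pair n -> Prop) : Q p -> (forall b q, Q q -> Q (punstep b q)) ->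
  forall X, X \in sl2z_orbit p -> exists2 q, Q q & X = origami_of q.
Proof.
move=> Qp QS X; pose S := [set X : {set hv_pair n} | `[< exists2 q, Q q & X = origami_of q >]].
have aS : [acts sl2z_act n, on S | 'P].
  rewrite gen_subG; apply/subsetP => z; rewrite !inE => /orP [] /eqP ->;
    apply/subsetP => Y; rewrite !inE => /asboolP [q Qq ->]; apply/asboolP.
    by exists (punstep true q); [apply: QS | rewrite -T_act_origami].
  by exists (punstep false q); [apply: QS | rewrite -S_act_origami].
have pS : origami_of p \in S by rewrite inE; apply/asboolP; exists p.
move=> XO; have /subsetP/(_ X XO) : sl2z_orbit p \subset S by rewrite acts_sub_orbit.
by rewrite inE => /asboolP.
Qed.

Lemma vertex_rep d (X : V) : admissible d p -> exists2 q, admissible d q & val X = origami_of q.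
Proof. by move=> gp; apply: orbit_rep (valP X) => // b q; apply: admissible_punstep. Qed.

Lemma vclass_proof (X : V) : [exists q, val X :|: @inv_pair n @: val X == class_of q].
Proof.
have [q _ ->] := @orbit_rep xpredT isT (fun _ _ _ => isT) _ (valP X).
by apply/existsP; exists q; rewrite inv_origami.
Qed.

Definition vclass (X : V) : origami_class n :=
  exist (fun A => [exists q, A == class_of q]) _ (vclass_proof X).

Lemma vclassE (X : V) q : val X = origami_of q -> vclass X = to_class q.
Proof. by move=> Xq; apply: val_inj; rewrite /= Xq inv_origami. Qed.

Lemma move_inj t b : injective (@move n t b p).
Proof. by move=> X Y /(congr1 val) /= /perm_inj /val_inj. Qed.

Definition unstep_vertex b : {perm V} := perm (@move_inj Parabolic (~~ b)).

Lemma unstep_vertexE b (X : V) :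
  val (unstep_vertex b X) = (if b then T_act n else S_act n) (val X).
Proof. by rewrite permE; case: b. Qed.

Lemma unstep_vertexV b (X : V) :
  val ((unstep_vertex b)^-1 X) = (if b then T_act n else S_act n)^-1 (val X).
Proof.
by apply: (@perm_inj _ (if b then T_act n else S_act n)); rewrite permKV -unstep_vertexE permKV.
Qed.

Lemma vclass_unstep b (X : V) : vclass (unstep_vertex b X) = unstep_perm n b (vclass X).
Proof.
have [q _ Xq] := @orbit_rep xpredT isT (fun _ _ _ => isT) _ (valP X).
rewrite (vclassE Xq) unstep_permE; apply: vclassE; rewrite unstep_vertexE Xq.
by case: b; rewrite ?T_act_origami ?S_act_origami.
Qed.

(** Elements induced by a permutation of the vertices; conjugation by them preserves the number of
    fixed vertices. *)
Definition lifts (y : {perm origami_class n}) :=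
  exists tau : {perm V}, forall X, vclass (tau X) = y (vclass X).

Lemma lifts_unstep b : lifts (unstep_perm n b).
Proof. by exists (unstep_vertex b) => X; rewrite vclass_unstep. Qed.

Lemma lifts1 : lifts 1.
Proof. by exists 1 => X; rewrite !perm1. Qed.

Lemma liftsM x y : lifts x -> lifts y -> lifts (x * y).
Proof. by move=> [a ax] [c cy]; exists (a * c) => X; rewrite !permM cy ax. Qed.

Lemma liftsV x : lifts x -> lifts x^-1.
Proof.
move=> [a ax]; exists a^-1 => X.
by apply: (@perm_inj _ x); rewrite permKV -ax permKV.
Qed.

Definition fixed_by (x : {perm origami_class n}) : {set V} :=
  [set X | x (vclass X) == vclass X].

Lemma fixed_byP (x : {perm origami_class n}) X :
  reflect (x (vclass X) = vclass X) (X \in fixed_by x).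
Proof. by rewrite in_set; apply: eqP. Qed.

Lemma fixed_byM x y X : X \in fixed_by x -> X \in fixed_by y -> X \in fixed_by (x * y).
Proof.
move=> /fixed_byP ex /fixed_byP ey; apply/fixed_byP.
by rewrite permM ex ey.
Qed.

Lemma fixed_byV x : fixed_by x^-1 = fixed_by x.
Proof.
apply/setP => X; apply/fixed_byP/fixed_byP => e; rewrite -{1}e; [exact: permKV|exact: permK].
Qed.

Lemma fixed_by_conj (x y : {perm origami_class n}) (tau : {perm V}) :
  (forall X, vclass (tau X) = y (vclass X)) -> fixed_by (x ^ y) = tau @: fixed_by x.
Proof.
have conjE c : (x ^ y) (y c) = y (x c) by rewrite permJ.
move=> ty; apply/setP => X; apply/idP/imsetP => [|[Y /fixed_byP Yx ->]]; last first.
  by apply/fixed_byP; rewrite ty conjE Yx.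
move=> /fixed_byP Xx; exists (tau^-1 X); last by rewrite permKV.
apply/fixed_byP; apply: (@perm_inj _ y).
by rewrite -conjE -ty permKV Xx.
Qed.

Lemma card_fixed_by_conj x y : lifts y -> #|fixed_by (x ^ y)| = #|fixed_by x|.
Proof. by case=> tau ty; rewrite (fixed_by_conj _ ty) card_imset //; apply: perm_inj. Qed.

(** Two translates by powers i < j of [y] meet only if [x] and its conjugate by y^(j-i) share a
    fixed point. So [J] disjoint copies of the fixed-point set fit in the orbit. *)
Lemma fixed_by_translates x y J : lifts y ->
  (forall j, (0 < j < J)%N -> fixed_by x :&: fixed_by (x ^ (y ^+ j)) = set0) ->
  (J * #|fixed_by x| <= #|V|)%N.
Proof.
move=> [tau ty] disj.
have tauX j X : vclass ((tau ^+ j) X) = (y ^+ j) (vclass X).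
  elim: j X => [|j IH] X; first by rewrite !expg0 !perm1.
  by rewrite !expgSr !permM ty IH.
pose D := setX [set: 'I_J] (fixed_by x).
have DE : #|D| = (J * #|fixed_by x|)%N by rewrite cardsX cardsT card_ord.
rewrite -DE -(card_in_imset (f := fun iX => (tau ^+ (iX.1 : 'I_J)) iX.2)) ?max_card //.
have lt_inj (i j : 'I_J) X Y : X \in fixed_by x -> Y \in fixed_by x -> (i < j)%N ->
    (tau ^+ i) X = (tau ^+ j) Y -> False.
  move=> Xx Yx ij e; have XE : X = (tau ^+ (j - i)%N) Y.
    by apply: (@perm_inj _ (tau ^+ i)); rewrite e -permM -expgD subnK // ltnW.
  have : X \in fixed_by x :&: fixed_by (x ^ (y ^+ (j - i)%N)).
    apply/setIP; split; first exact: Xx.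
    rewrite XE (fixed_by_conj x (tauX (j - i)%N)).
    exact: imset_f.
  by rewrite disj ?inE // subn_gt0 ij (leq_ltn_trans (leq_subr _ _)).
move=> [i X] [j Y]; rewrite !inE /= => Xx Yx e.
have [ij|ji|/val_inj ij] := ltngtP i j.
- by exfalso; apply: (lt_inj i j X Y) => //; rewrite inE.
- by exfalso; apply: (lt_inj j i Y X) => //; rewrite inE.
by move: e; rewrite ij => /perm_inj ->.
Qed.

End Orbit.

(** * Every nontrivial word fixes a small proportion of a large orbit *)

Section Rarity.
Local Notation t n := (unstep_perm n true).
Local Notation s n := (unstep_perm n false).
Definition class_word n w := word_val (rot_R n) (rot_U n) w.
Definition class_pos n l := pos_val (t n) (s n) l.

Lemma lifts_pos n (p : hv_pair n) l : lifts p (class_pos n l).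
Proof.
rewrite /class_pos /pos_val; elim: l => [|e l IH]; first by rewrite big_nil; apply: lifts1.
by rewrite big_cons; apply: liftsM => //; case: e; apply/liftsV/lifts_unstep.
Qed.

Lemma lifts_word n (p : hv_pair n) w : lifts p (class_word n w).
Proof.
rewrite /class_word /word_val; elim: w => [|e w IH]; first by rewrite big_nil; apply: lifts1.
have lt := lifts_unstep p true; have ls := lifts_unstep p false.
have lU : lifts p (rot_U n) by apply: liftsM => //; apply: liftsV.
rewrite big_cons; apply: liftsM => //; case: e => [[]|] //=; first exact: liftsV.
exact: liftsM (liftsM (liftsV lt) ls) (liftsV lt).
Qed.

Lemma class_pos_pact n l (q : hv_pair n) : class_pos n l (to_class q) = to_class (pact l q).
Proof.
rewrite /class_pos /pos_val; elim: l q => [|e l IH] q; first by rewrite big_nil perm1.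
by rewrite big_cons permM (_ : (if e then _ else _) =
  (unstep_perm n e)^-1) ?step_permE ?IH //; case: e.
Qed.

(** Doubling the word removes the sign ambiguity of a class. *)
Lemma fixed_class_pact n l (q : hv_pair n) : class_pos n l (to_class q) = to_class q ->
  exists g, pact (l ++ l) q = conj_pair q g.
Proof.
rewrite class_pos_pact => /(congr1 val) /= /esym/class_ofP [g [e|e]];
  rewrite /pact foldl_cat -/(pact l q) -/(pact l _).
  by exists (g * g); rewrite e pact_conj e conj_pairM.
have [g' e'] := pact_inv l q.
exists (g * (g' * g)); rewrite e pact_conj e' e -!conj_inv_pair inv_pairK !conj_pairM.
by [].
Qed.

Definition vanishing (x : forall n, {perm origami_class n}) := forall d, exists N,
  forall n (p : hv_pair n), admissible d.+1 p -> (N <= n)%N -> fixed_by p (x n) = set0.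

Definition rare (x : forall n, {perm origami_class n}) := forall d J, exists N,
  forall n (p : hv_pair n), admissible d.+1 p -> (N <= n)%N ->
    (J * #|fixed_by p (x n)| <= #|orbit_vertex p|)%N.

Lemma vanishing_square l b l' : l = b :: rcons l' (~~ b) -> vanishing (fun n => class_pos n l).
Proof.
move=> lE d; pose L := b :: rcons (l' ++ [:: ~~ b, b & l']) (~~ b).
exists (d.+1.+2 * ((2 ^ size L).+1 ^ d.+2 * (2 ^ size L) ^ d.+1.+2)).+1%N => n p gp Nn.
apply/setP => X; rewrite !inE; apply/negP => /eqP fX.
have [q [bt cn irr] Xq] := vertex_rep X gp.
have lL : L = l ++ l by rewrite /L lE -!cats1 /= -!catA.
move: fX; rewrite (vclassE Xq) => /fixed_class_pact [g]; rewrite -lL => e.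
have aL x : pos_act L (letters q) x = letters q x ^ g.
  by rewrite -letters_pact e; case: x.
(* Real algebraic numbers contain the Perron root, a root of an integral quadratic polynomial. *)
have := @number_of_squares_bound n (letters q) b _ g realalg aL cn bt; rewrite irr.
move=> /(_ isT) le; move: Nn; rewrite ltnNge; apply/negP; rewrite negbK; exact: le.
Qed.

(** Cut the word at its first change of letter. *)
Lemma rotate_mixed l : true \in l -> false \in l ->
  exists l1 l2, l = l1 ++ l2 /\ exists b l', l2 ++ l1 = b :: rcons l' (~~ b).
Proof.
case: l => // x m tl fl; have nm : ~~ x \in m.
  by case: x tl fl => /=; rewrite !inE.
pose i := index (~~ x) m.
have mE : m = take i m ++ ~~ x :: drop i.+1 m.
  by rewrite -[X in X :: _](nth_index true nm) -drop_nth ?index_mem // cat_take_drop.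
exists (x :: take i m), (~~ x :: drop i.+1 m); split; first by rewrite {1}mE.
exists (~~ x), (drop i.+1 m ++ belast x (take i m)).
rewrite negbK [x :: take i m]lastI -cats1 catA cats1 cat_cons; congr (_ :: rcons _ _).
have : last x (take i m) \in x :: take i m by apply: mem_last.
rewrite inE => /orP [/eqP //|lt].
have : last x (take i m) != ~~ x.
  by apply: contraTneq lt => ->; rewrite in_take // ltnn.
by case: (last _ _) => //=; case: (x).
Qed.

Lemma vanishing_mixed l : true \in l -> false \in l -> vanishing (fun n => class_pos n l).
Proof.
move=> tl fl; have [l1 [l2 [lE [b [l' l'E]]]]] := rotate_mixed tl fl.
move=> d; have [N NP] := vanishing_square l'E d; exists N => n p gp Nn.
have e : class_pos n (l2 ++ l1) = class_pos n l ^ class_pos n l1.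
  by rewrite lE /class_pos !pos_val_cat conjgE !mulgA mulVg mul1g.
apply/eqP; rewrite -cards_eq0 -(card_fixed_by_conj _ (lifts_pos p l1)) -e.
by rewrite NP // cards0.
Qed.

Lemma rare_translates x (y : forall n, {perm origami_class n}) :
  (forall n p, @lifts n p (y n)) -> (forall j, (0 < j)%N -> exists2 z, vanishing z &
    forall n (p : hv_pair n),
      fixed_by p (x n) :&: fixed_by p (x n ^ (y n ^+ j)) \subset fixed_by p (z n)) ->
  rare x.
Proof.
move=> ly H d J.
have /choice [N NP] : forall j, exists N, forall n (p : hv_pair n), (0 < j)%N -> admissible
  d.+1 p -> (N <= n)%N ->
    fixed_by p (x n) :&: fixed_by p (x n ^ (y n ^+ j)) = set0.
  move=> j; have [->|j0] := posnP j; first by exists 0%N.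
  have [z vz zP] := H j j0; have [N NP] := vz d; exists N => n p _ gp Nn.
  by apply/eqP; rewrite -subset0 -(NP n p gp Nn); apply: zP.
exists (\max_(j < J) N j)%N => n p gp Nn.
apply: (fixed_by_translates (ly n p)) => j /andP [j0 jJ].
by apply: NP => //; apply: leq_trans Nn; apply: (leq_bigmax (Ordinal jJ)).
Qed.

Lemma rare_eq x y : (forall n, x n = y n) -> rare x -> rare y.
Proof. by move=> e rx d J; have [N NP] := rx d J; exists N => n p; rewrite -e; apply: NP. Qed.

Lemma rare_conj x (y : forall n, {perm origami_class n}) :
  (forall n p, @lifts n p (y n)) -> rare (fun n => x n ^ y n) -> rare x.
Proof.
move=> ly rx d J; have [N NP] := rx d J; exists N => n p gp Nn.
by rewrite -(card_fixed_by_conj _ (ly n p)); apply: NP.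
Qed.

Lemma rare_inv x : rare x -> rare (fun n => (x n)^-1).
Proof. by move=> rx d J; have [N NP] := rx d J; exists N => n p; rewrite fixed_byV;
  apply: NP. Qed.

Lemma rare_vanishing x : vanishing x -> rare x.
Proof.
move=> vx d J; have [N NP] := vx d; exists N => n p gp Nn.
by rewrite NP // cards0 muln0.
Qed.

Section Relations.
Variable n : nat.
Let rE : rot_R n = (t n)^-1 * s n * (t n)^-1 := erefl.
Let uE : rot_U n = (s n)^-1 * t n := erefl.
Definition class_nf := nf_val_nf rE uE (rot_R2 n) (rot_U3 n).
Definition class_R_conj := rot_R_conj rE uE (rot_R2 n) (rot_U3 n).
Definition class_U_conj := rot_U_conj rE uE (rot_R2 n) (rot_U3 n).
Definition class_twist_conj := twist_conj rE uE (rot_R2 n) (rot_U3 n).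
Definition class_nf_both := nf_conj_both rE uE (rot_R2 n) (rot_U3 n).
Definition class_nf_left := nf_conj_left rE uE (rot_R2 n) (rot_U3 n).
Definition class_nf_right := nf_conj_right rE uE (rot_R2 n) (rot_U3 n).
Definition class_t_conj := t_conj rE uE (rot_R2 n) (rot_U3 n).
End Relations.

Lemma lifts_R n p : @lifts n p (rot_R n).
Proof. by have := lifts_word p [:: None]; rewrite /class_word /word_val big_seq1. Qed.

Lemma lifts_U n p : @lifts n p (rot_U n).
Proof. by have := lifts_word p [:: Some true]; rewrite /class_word /word_val big_seq1. Qed.

Lemma class_pos_ts n j : (class_pos n (nseq j true ++ nseq j false))^-1 = s n ^+ j * t n ^+ j.
Proof. by rewrite /class_pos pos_val_cat !pos_val_nseq invMg !invgK. Qed.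

Lemma rare_R : rare rot_R.
Proof.
apply: (rare_translates (fun n p => lifts_unstep p true)) => j j0.
exists (fun n => class_pos n (nseq j true ++ nseq j false)).
  by apply: vanishing_mixed; rewrite mem_cat !mem_nseq j0 ?orbT.
move=> n p; rewrite -[in X in _ \subset X]fixed_byV class_pos_ts -class_R_conj.
apply/subsetP => X /setIP [h1 h2]; exact: fixed_byM h1 h2.
Qed.

Lemma rare_U : rare rot_U.
Proof.
apply: (rare_translates (fun n p => lifts_unstep p true)) => j j0.
exists (fun n => class_pos n (nseq j true ++ nseq j false)).
  by apply: vanishing_mixed; rewrite mem_cat !mem_nseq j0 ?orbT.
move=> n p; rewrite -[in X in _ \subset X]fixed_byV class_pos_ts -class_U_conj.
apply/subsetP => X /setIP [h1 h2]; apply: fixed_byM h2; rewrite fixed_byV; exact: h1.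
Qed.

Lemma rare_twist k : rare (fun n => t n ^+ k.+1).
Proof.
apply: (rare_translates (fun n p => lifts_unstep p false)) => -[//|j] _.
(* The word of [twist_conj]; its two isolated letters keep it mixed even for [k = j = 0]. *)
pose l := [:: false] ++ nseq k true ++ nseq j false ++ [:: true] ++ nseq k false ++ nseq j true.
exists (fun n => (t n ^- k.+1 * (t n ^+ k.+1) ^ (s n ^+ j.+1))).
  have vl : vanishing (fun n => class_pos n l).
    by apply: vanishing_mixed; rewrite !mem_cat !inE ?orbT.
  move=> d; have [N NP] := vl d; exists N => n p gp Nn.
  apply/eqP; rewrite -cards_eq0 -(card_fixed_by_conj _ (liftsV (lifts_U p))).
  by rewrite conjgE invgK mulgA class_twist_conj NP // cards0.
move=> n p; apply/subsetP => X /setIP [h1 h2]; apply: fixed_byM h2; rewrite fixed_byV;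
  exact: h1.
Qed.

Lemma rare_pos l : l != [::] -> rare (fun n => class_pos n l).
Proof.
move=> l0; have [tl|tl] := boolP (true \in l); have [fl|fl] := boolP (false \in l).
- exact/rare_vanishing/vanishing_mixed.
- have -> : l = nseq (size l).-1.+1 true.
    rewrite prednK ?lt0n ?size_eq0 //; apply/all_pred1P/allP => -[] // h; by rewrite h in fl.
  apply: (rare_eq (x := fun n => (t n ^+ (size l).-1.+1)^-1)).
    by move=> n; rewrite /class_pos pos_val_nseq.
  exact/rare_inv/rare_twist.
- have -> : l = nseq (size l).-1.+1 false.
    rewrite prednK ?lt0n ?size_eq0 //; apply/all_pred1P/allP => -[] // h; by rewrite h in tl.
  apply: (rare_conj (fun n p => lifts_R p)).
  apply: (rare_eq (x := fun n => t n ^+ (size l).-1.+1)); last exact: rare_twist.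
  move=> n; rewrite /class_pos pos_val_nseq class_t_conj conjgE (rV (rot_R2 n));
    exact: esym (mulgA _ _ _).
by case: l l0 tl fl => // x m _; rewrite !inE; case: x.
Qed.

Lemma rare_letter e : rare (fun n => letter_val (rot_R n) (rot_U n) (Some e)).
Proof. by case: e => /=; [exact: rare_U | exact/rare_inv/rare_U]. Qed.

Lemma lifts_letter e n p : @lifts n p (letter_val (rot_R n) (rot_U n) (Some e)).
Proof. by case: e => /=; [exact: lifts_U | exact/liftsV/lifts_U]. Qed.

(** Cyclic reduction shortens the middle word until the element is [r], u^(+-1) or a nonempty
    positive word. *)
Lemma rare_nf f : f != (false, [::], None) ->
  rare (fun n => nf_val (t n) (s n) (rot_R n) (rot_U n) f).
Proof.
case: f => -[a l] c; have [k] := ubnP (size l); elim: k a l c => // k IH a l c lk f0.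
case: a c f0 => [] [e|] f0.
- apply: (rare_conj (fun n p => lifts_R p)).
  apply: (rare_eq (x := fun n => class_pos n (rcons l e))); last by apply: rare_pos; case: (l).
  by move=> n; rewrite class_nf_both.
- case/lastP: l lk {f0} => [|l e] lk.
    by apply: rare_eq rare_R => n; rewrite /nf_val /= /pos_val big_nil !mulg1.
  apply: (rare_conj (fun n p => lifts_R p)).
  have lk' : (size l < k)%N by move: lk; rewrite size_rcons ltnS.
  apply: rare_eq (IH false l (Some e) lk' _) => [n|]; last by rewrite xpair_eqE andbF.
  by rewrite class_nf_left.
- case: l lk f0 => [|e' l] lk _.
    by apply: rare_eq (rare_letter e) => n; rewrite /nf_val /pos_val big_nil !mul1g.
  apply: (rare_conj (fun n p => liftsV (lifts_letter e p))).
  have [ee|ee] := eqVneq e e'.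
    apply: (rare_eq (x := fun n => class_pos n (~~ e :: l))); last exact: rare_pos.
    by move=> n; rewrite class_nf_right ee eqxx.
  apply: rare_eq (IH true l None lk _) => [n|]; last by [].
  by rewrite class_nf_right (negPf ee).
- apply: (rare_eq (x := fun n => class_pos n l)); last by apply: rare_pos;
  apply: contraNneq f0 => ->.
  by move=> n; rewrite /nf_val mul1g mulg1.
Qed.

Lemma rare_word w : nf w != (false, [::], None) -> rare (fun n => class_word n w).
Proof. by move=> /rare_nf; apply: rare_eq => n; rewrite class_nf. Qed.

Lemma rare_words (W : seq (seq (option bool))) :
  (forall w, w \in W -> nf w != (false, [::], None)) ->
  forall d J, exists N, forall n (p : hv_pair n), admissible d.+1 p -> (N <= n)%N ->
    forall w, w \in W -> (J * #|fixed_by p (class_word n w)| <= #|orbit_vertex p|)%N.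
Proof.
elim: W => [|w W IH] Wr d J; first by exists 0%N.
have WrW w' : w' \in W -> nf w' != (false, [::], None).
  by move=> w'W; apply: Wr; rewrite inE w'W orbT.
have [N NP] := IH WrW d J.
have [N' NP'] := rare_word (Wr w (mem_head _ _)) d J.
exists (maxn N N') => n p gp; rewrite geq_max => /andP [Nn N'n] w'.
by rewrite inE => /predU1P [->|]; [apply: NP' | apply: NP].
Qed.

Lemma fixed_by_unstep_pow n (p : hv_pair n) b (X : orbit_vertex p) :
  exists2 k, (0 < k <= #|orbit_vertex p|)%N & X \in fixed_by p (unstep_perm n b ^+ k).
Proof.
exists #|porbit (unstep_vertex p b) X|.
  by rewrite max_card andbT lt0n cards_eq0; apply/set0Pn; exists X; apply: porbit_id.
have powE k Y : vclass ((unstep_vertex p b ^+ k) Y) = (unstep_perm n b ^+ k) (vclass Y).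
  elim: k Y => [|k IH] Y; first by rewrite !expg0 !perm1.
  by rewrite !expgSr !permM vclass_unstep IH.
apply/fixed_byP; rewrite -powE; congr (vclass _).
by rewrite permX iter_porbit.
Qed.

(** In an orbit with fewer than [J] elements, each element is fixed by powers of T and S with
    positive exponents below [J], hence by one of finitely many mixed words. *)
Lemma orbit_large d J : exists N, forall n (p : hv_pair n), admissible d.+1 p -> (N <= n)%N ->
  (J <= #|orbit_vertex p|)%N.
Proof.
pose l (km : 'I_J * 'I_J) := nseq km.1.+1 true ++ nseq km.2.+1 false.
have /choice [N NP] : forall km, exists N, forall n (p : hv_pair n), admissible d.+1 p -> (N
  <= n)%N ->
    fixed_by p (class_pos n (l km)) = set0.
  by move=> km; apply: vanishing_mixed; rewrite mem_cat !mem_nseq /= ?orbT.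
exists (\max_km N km) => n p gp Nn; rewrite leqNgt; apply/negP => VJ.
pose X : orbit_vertex p := exist (fun Y => Y \in sl2z_orbit p) _ (orbit_refl _ _ _).
have [[//|k] /andP [_ kV] Xk] := fixed_by_unstep_pow true X.
have [[//|m] /andP [_ mV] Xm] := fixed_by_unstep_pow false X.
pose km := (Ordinal (leq_trans kV (ltnW VJ)), Ordinal (leq_trans mV (ltnW VJ))).
have := NP km n p gp (leq_trans (leq_bigmax km) Nn) => /setP/(_ X).
rewrite in_set0 => /negP; apply.
rewrite /class_pos pos_val_cat !pos_val_nseq; apply: fixed_byM; rewrite fixed_byV;
  [exact: Xk | exact: Xm].
Qed.

End Rarity.

(** * Faces *)

(* In units of 1/42.  In the elliptic case a bigon R R and a triangle U U U both have
   weight 1, and the corners at a vertex have total weight at most 21 + 14 + 3 + 3 = 41. *)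
Definition corner_weight t (b b' : bool) : nat :=
  match t with
  | Parabolic => 10
  | Elliptic => if b && b' then 14 else if b || b' then 3 else 21
  end.

(** The second component [true] marks an inverse. In the parabolic case t = r u^-1 and s = r u. *)
Definition letter_word t (l : bool * bool) : seq (option bool) :=
  match t, l with
  | Parabolic, (false, false) => [:: None; Some false]
  | Parabolic, (false, true) => [:: Some true; None]
  | Parabolic, (true, false) => [:: None; Some true]
  | Parabolic, (true, true) => [:: Some false; None]
  | Elliptic, (false, _) => [:: None]
  | Elliptic, (true, b) => [:: Some (~~ b)]
  end.

Definition letters_word t (w : seq (bool * bool)) := flatten [seq letter_word t l | l <- w].

Definition reduced_step (l l' : bool * bool) := l' != (l.1, ~~ l.2).

Fixpoint path_weight t (l : bool * bool) (w : seq (bool * bool)) (l' : bool * bool) : nat :=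
  if w is m :: w' then corner_weight t l.1 m.1 + path_weight t m w' l' else corner_weight t
    l.1 l'.1.

Definition nf_one : normal_form := (false, [::], None).

Definition all_letters : seq (bool * bool) :=
  [:: (false, false); (false, true); (true, false); (true, true)].

(* [w] runs through the reduced words from [l] to [m] of weight less than 42; [k] bounds
   the number of letters still to be added. *)
Fixpoint explore k t (l m : bool * bool) weight w : bool :=
  (if reduced_step m l && (weight + corner_weight t m.1 l.1 < 42)
   then nf (letters_word t w) != nf_one else true) &&
  (if k is k'.+1 then
     all (fun z => if reduced_step m z && (weight + corner_weight t m.1 z.1 < 42)
       then explore k' t l z (weight + corner_weight t m.1 z.1) (rcons w z) else true)
         all_letters
   else true).

Lemma exploreS k t l m weight w : explore k.+1 t l m weight w =
  (if reduced_step m l && (weight + corner_weight t m.1 l.1 < 42)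
   then nf (letters_word t w) != nf_one else true) &&
  all (fun z => if reduced_step m z && (weight + corner_weight t m.1 z.1 < 42)
    then explore k t l z (weight + corner_weight t m.1 z.1) (rcons w z) else true) all_letters.
Proof. by []. Qed.

Lemma exploreP k t l m weight w v : explore k t l m weight w -> size v <= k ->
  path reduced_step m (rcons v l) -> weight + path_weight t m v l < 42 ->
  nf (letters_word t (w ++ v)) != nf_one.
Proof.
elim: v k m weight w => [|z v IH] k m weight w.
  by case: k => [|k] /= /andP [+ _] _; rewrite andbT cats0 => + h1 h2; rewrite h1 h2.
case: k => // k; rewrite exploreS => /andP [_ /allP H] sv /= /andP [mz zp]; rewrite addnA => wl.
rewrite -cat_rcons; apply: (IH _ _ _ _ _ sv zp wl).
have zl : z \in all_letters by case: (z) => -[] -[].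
move: (H z zl); rewrite mz (leq_ltn_trans _ wl) //; exact: leq_addr.
Qed.

(** A finite computation. A corner weighs at least 3, so a cyclic word of weight below 42 has at
    most 13 letters, the first of which is given. *)
Lemma explore_all t : all (fun l => explore 12 t l l 0 [:: l]) all_letters.
Proof. by case: t; vm_compute. Qed.

Lemma path_weight_ge t l w l' : 3 * (size w).+1 <= path_weight t l w l'.
Proof.
have c3 b b' : 3 <= corner_weight t b b' by case: t b b' => -[] [].
elim: w l => [|m w IH] l /=; first by rewrite muln1.
by rewrite mulnS leq_add.
Qed.

Lemma light_word t l w : path reduced_step l (rcons w l) -> path_weight t l w l < 42 ->
  size w <= 12 /\ nf (letters_word t (l :: w)) != nf_one.
Proof.
move=> lw wl; have sw : size w <= 12.
  by have := leq_ltn_trans (path_weight_ge t l w l) wl; rewrite -(ltn_pmul2l (m := 3)) //; lia.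
split=> //; apply: (@exploreP 12 t l l 0 [:: l]) => //.
by apply: (allP (explore_all t)); case: (l) => -[] -[].
Qed.

Lemma corner_weights_sum t (l0 l1 l2 l3 : bool * bool) : uniq [:: l0; l1; l2; l3] ->
  corner_weight t l0.1 l1.1 + (corner_weight t l1.1 l2.1 +
    (corner_weight t l2.1 l3.1 + corner_weight t l3.1 l0.1)) <= 41.
Proof.
by case: l0 l1 l2 l3 => [[] []] [[] []] [[] []] [[] []]; case: t.
Qed.

(** * Faces of an embedding as cyclic words *)

Section Faces.
Variables (n : nat) (p : hv_pair n) (t : generator_pair).
Local Notation G := (orbit_graph t p).
Local Notation V := (orbit_vertex p).

Definition class_gen b : {perm origami_class n} :=
  match t with
  | Parabolic => unstep_perm n (~~ b)
  | Elliptic => if b then rot_U n else rot_R n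
  end.

Definition letter_gen (l : bool * bool) := if l.2 then (class_gen l.1)^-1 else class_gen l.1.

Lemma vclass_move b (X : V) : vclass (move t b X) = class_gen b (vclass X).
Proof.
rewrite /class_gen; case: t b => -[].
- have -> : move Parabolic true X = unstep_vertex p false X by apply: val_inj;
  rewrite unstep_vertexE.
  exact: vclass_unstep.
- have -> : move Parabolic false X = unstep_vertex p true X by apply: val_inj;
  rewrite unstep_vertexE.
  exact: vclass_unstep.
- have -> : move Elliptic true X = unstep_vertex p true ((unstep_vertex p false)^-1 X).
    by apply: val_inj; rewrite unstep_vertexE unstep_vertexV /= permM.
  rewrite vclass_unstep /rot_U permM; congr (_ _).
  by apply: (@perm_inj _ (unstep_perm n false)); rewrite -vclass_unstep !permKV.
have E Y : vclass ((unstep_vertex p true)^-1 Y) = (unstep_perm n true)^-1 (vclass Y).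
  by apply: (@perm_inj _ (unstep_perm n true)); rewrite -vclass_unstep !permKV.
have -> : move Elliptic false X =
    (unstep_vertex p true)^-1 (unstep_vertex p false ((unstep_vertex p true)^-1 X)).
  by apply: val_inj; rewrite unstep_vertexV unstep_vertexE unstep_vertexV /= !permM.
by rewrite E vclass_unstep E /rot_R !permM.
Qed.

Lemma class_word_cat w1 w2 : class_word n (w1 ++ w2) = class_word n w1 * class_word n w2.
Proof. exact: big_cat. Qed.

Lemma class_word_letter l : class_word n (letter_word t l) = letter_gen l.
Proof.
have rV := @rV _ _ (rot_R2 n).
have ur := ur (erefl (rot_R n)) (erefl (rot_U n)).
have uVr := uVr (erefl (rot_R n)) (erefl (rot_U n)) (rot_R2 n) (rot_U3 n).
have ruV : rot_R n * (rot_U n)^-1 =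
  unstep_perm n true by rewrite -[RHS]invgK -ur (invMg (rot_U n) (rot_R n)) rV.
have ru : rot_R n * rot_U n = unstep_perm n false by rewrite -[RHS]invgK -uVr (invMg (rot_U
  n)^-1 (rot_R n)) (invgK (rot_U n)) rV.
rewrite /class_word /word_val /letter_gen /class_gen.
by case: t l => -[[] []] /=; rewrite ?big_cons big_nil ?mulg1 //= rV.
Qed.

Definition letter (d : dart G) : bool * bool := (d.1.2, d.2).

Lemma vclass_flip (d : dart G) : vclass (anchor (flip d)) =
  letter_gen (letter d) (vclass (anchor d)).
Proof.
by case: d => -[X b] [] /=; rewrite /anchor /flip /letter_gen /= vclass_move ?permK.
Qed.

Lemma dart_eq (d d' : dart G) : anchor d = anchor d' -> letter d = letter d' -> d = d'.
Proof.
case: d d' => -[X b] s [[Y b'] s'] + [bb ss]; rewrite bb ss /anchor /=.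
by case: s' {ss} => /= [/move_inj ->|->].
Qed.

Definition dart_at (X : V) (l : bool * bool) : dart G :=
  ((if l.2 then (perm (@move_inj n p t l.1))^-1 X else X, l.1), l.2).

Lemma anchor_dart_at X l : anchor (dart_at X l) = X.
Proof.
by case: l => b []; rewrite /anchor /dart_at //= -[LHS](permE (@move_inj n p t b)) permKV.
Qed.

Lemma letter_dart_at X l : letter (dart_at X l) = l.
Proof. by case: l. Qed.

Lemma card_darts_at (X : V) : #|[set d : dart G | anchor d == X]| = 4.
Proof.
rewrite (_ : 4 = #|{: bool * bool}|); last by rewrite card_prod card_bool.
rewrite -cardsT -(card_imset _ (can_inj (letter_dart_at X))).
apply: eq_card => d; rewrite inE; apply/eqP/imsetP => [dX|[l _ ->]]; last exact: anchor_dart_at.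
by exists (letter d) => //; apply: dart_eq; rewrite ?anchor_dart_at ?letter_dart_at.
Qed.

Section Rotation.
Variable rho : {perm dart G}.
Hypothesis rot : rotation_system rho.
Local Notation phi := (flip_perm G * rho).

Lemma porbit_rho d : porbit rho d = [set d' | anchor d' == anchor d].
Proof. by apply/eqP; move/forallP: rot. Qed.

Lemma anchor_rho d : anchor (rho d) = anchor d.
Proof.
by have := mem_porbit rho 1 d; rewrite expg1 porbit_rho inE => /eqP.
Qed.

Lemma card_porbit_rho d : #|porbit rho d| = 4.
Proof. by rewrite porbit_rho card_darts_at. Qed.

Lemma phiE d : phi d = rho (flip d).
Proof. by rewrite permM permE. Qed.

(** Backtracking would make [rho] fix a dart, while its cycles have length 4. *)
Lemma reduced_phi d : reduced_step (letter d) (letter (phi d)).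
Proof.
rewrite /reduced_step; apply/eqP => e.
have fix_flip : rho (flip d) = flip d.
  by apply: dart_eq; [exact: anchor_rho | rewrite -phiE e].
have : #|porbit rho (flip d)| <= 1.
  rewrite -(cards1 (flip d)) subset_leq_card //; apply/subsetP => _ /porbitP [k ->].
  rewrite inE; elim: k => [|k IH]; first by rewrite expg0 perm1.
  by rewrite expgS permM fix_flip.
by rewrite card_porbit_rho.
Qed.

Lemma vclass_phi d : vclass (anchor (phi d)) = letter_gen (letter d) (vclass (anchor d)).
Proof. by rewrite phiE anchor_rho vclass_flip. Qed.

Lemma vclass_traject d k :
  vclass (anchor (iter k phi d)) =
  class_word n (letters_word t (map letter (traject phi d k))) (vclass (anchor d)).
Proof.
elim: k d => [|k IH] d; first by rewrite /class_word /word_val big_nil perm1.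
rewrite iterSr IH vclass_phi -class_word_letter -permM -class_word_cat.
by [].
Qed.

Definition corner (d : dart G) := corner_weight t (letter d).1 (letter (phi d)).1.

Lemma sum_corner : \sum_d corner d <= 41 * #|V|.
Proof.
have -> : \sum_d corner d = \sum_(d : dart G) corner_weight t (letter d).1 (letter (rho d)).1.
  rewrite [RHS](reindex_inj (inv_inj (@flipK G))); apply: eq_bigr => d _.
  by rewrite /corner phiE.
rewrite (partition_big (@anchor G) xpredT) //= mulnC -sum_nat_const.
apply: leq_sum => X _; pose d0 := dart_at X (false, false).
rewrite (eq_bigl (mem (porbit rho d0))); last first.
  by move=> d; rewrite /= porbit_rho inE anchor_dart_at.
rewrite (eq_bigl _ _ (porbit_traject rho d0)) -big_uniq ?uniq_traject_porbit //=.
have := iter_porbit rho d0; have := uniq_traject_porbit rho d0; rewrite card_porbit_rho /=.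
rewrite !big_cons big_nil addn0 => u4 ->.
apply: (@corner_weights_sum t (letter d0) (letter (rho d0)) (letter (rho (rho d0)))
  (letter (rho (rho (rho d0))))).
have inj : {in traject rho d0 4 &, injective letter}.
  have an d : d \in traject rho d0 4 -> anchor d = X.
    by rewrite -(card_porbit_rho d0) -porbit_traject porbit_rho inE anchor_dart_at => /eqP.
  by move=> d d' /an e /an e' /dart_eq; apply; rewrite e.
by rewrite -[X in uniq X]/(map letter (traject rho d0 4)) (map_inj_in_uniq inj).
Qed.

Lemma sum_traject d k : \sum_(d' <- traject phi d k.+1) corner d' =
  path_weight t (letter d) (map letter (traject phi (phi d) k)) (letter (iter k.+1 phi d)).
Proof.
elim: k d => [|k IH] d; first by rewrite big_seq1.
by rewrite trajectS big_cons IH /= -iterSr.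
Qed.

Lemma path_traject d k :
  path reduced_step (letter d) (rcons (map letter (traject phi (phi d) k)) (letter (iter k.+1
    phi d))).
Proof.
elim: k d => [|k IH] d; first by apply/andP; split; first exact: reduced_phi.
by rewrite iterSr; apply/andP; split; [exact: reduced_phi | exact: IH].
Qed.

Definition face_word d := map letter (traject phi d #|porbit phi d|).
Definition light d := \sum_(d' in porbit phi d) corner d' < 42.

Lemma light_face d : light d ->
  size (face_word d) <= 13 /\ nf (letters_word t (face_word d)) != nf_one.
Proof.
have per := iter_porbit phi d.
rewrite /light /face_word (eq_bigl _ _ (porbit_traject phi d)) -big_uniq ?uniq_traject_porbit
  //=.
have : 0 < #|porbit phi d| by rewrite lt0n cards_eq0; apply/set0Pn; exists d; apply: porbit_id.
move: per; case: #|_| => // k per _; rewrite sum_traject per => /light_word.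
have := path_traject d k; rewrite per => pd /(_ pd) [].
by rewrite /= size_map size_traject ltnS.
Qed.

Lemma light_fixed d : light d ->
  anchor d \in fixed_by p (class_word n (letters_word t (face_word d))).
Proof. by move=> _; apply/fixed_byP; rewrite -vclass_traject iter_porbit. Qed.

(** A face of weight at least 42 is paid for by its corners, a lighter one by its own darts, all of
    which are light. *)
Lemma num_faces_light : 42 * num_faces rho <= 41 * #|V| + 42 * #|[set d | light d]|.
Proof.
apply: leq_trans (leq_add sum_corner (leqnn _)).
rewrite (partition_big (porbit phi) (mem (porbits phi))); last first.
  by move=> d _; apply: imset_f.
have -> : #|[set d | light d]| =
  \sum_(F in porbits phi) #|[set d | light d & porbit phi d == F]|.
  rewrite -sum1_card (partition_big (porbit phi) (mem (porbits phi))); last first.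
    by move=> d _; apply: imset_f.
  by apply: eq_bigr => F _; rewrite -sum1_card; apply: eq_bigl => d; rewrite !inE.
rewrite /num_faces -sum1_card !big_distrr /= -big_split /=.
apply: leq_sum => _ /imsetP [d _ ->]; rewrite muln1.
have -> : \sum_(d' | porbit phi d' == porbit phi d) corner d' =
  \sum_(d' in porbit phi d) corner d'.
  by apply: eq_bigl => d'; rewrite eq_porbit_mem.
case: (ltnP (\sum_(d' in porbit phi d) corner d') 42) => [ld|]; last first.
  by move=> h; apply: leq_trans h (leq_addr _ _).
apply: leq_trans (leq_addl _ _); rewrite -{1}[42]muln1 leq_pmul2l // lt0n cards_eq0.
by apply/set0Pn; exists d; rewrite !inE eqxx andbT.
Qed.
End Rotation.
End Faces.

(** * Counting light faces, and the Euler characteristic *)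

Fixpoint words_upto k : seq (seq (bool * bool)) :=
  if k is k'.+1 then [::] :: [seq x :: w | x <- all_letters, w <- words_upto k'] else [:: [::]].

Lemma mem_words_upto k w : size w <= k -> w \in words_upto k.
Proof.
elim: k w => [|k IH] [|x w] // sw;
  rewrite -[words_upto _]/([::] :: [seq y :: v | y <- all_letters, v <- words_upto k]) in_cons.
apply/orP; right; apply: allpairs_f; last exact: IH.
by case: x {sw} => -[] [].
Qed.

Definition light_words t : seq (seq (bool * bool)) :=
  [seq w <- words_upto 13 | nf (letters_word t w) != nf_one].

(** The first letter of a face word is the letter of its dart, so the word and the anchor determine
    the dart; and the class of the anchor is fixed by the word. *)
Lemma card_light n (p : hv_pair n) t (rho : {perm dart (orbit_graph t p)}) :
  rotation_system rho ->
  #|[set d | light rho d]| <=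
    \sum_(w <- light_words t) #|fixed_by p (class_word n (letters_word t w))|.
Proof.
move=> rot; apply: leq_trans (_ : \sum_(w <- light_words t) #|[set d | light rho d &
  face_word rho d == w]| <= _).
  have -> : \sum_(w <- light_words t) #|[set d | light rho d & face_word rho d == w]| =
      \sum_(w <- light_words t) \sum_(d | light rho d) (face_word rho d == w : nat).
    apply: eq_bigr => w _; rewrite -sum1_card [LHS]big_mkcond [RHS]big_mkcond.
    by apply: eq_bigr => d _; rewrite inE; case: (light _ _); case: eqP.
  rewrite exchange_big /= -sum1_card (eq_bigl (light rho)); last by move=> d; rewrite inE.
  apply: leq_sum => d ld; have [sd nd] := light_face rot ld.
  rewrite (big_rem (face_word rho d)) ?eqxx //= mem_filter nd.
  exact: mem_words_upto.
apply: leq_sum => w _; set D := [set d | _].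
have inj : {in D &, injective (@anchor (orbit_graph t p))}.
  move=> d d'; rewrite !inE => /andP [_ /eqP wd] /andP [_ /eqP wd'] e.
  apply: dart_eq => //.
  have head_word e0 : head (false, false) (face_word rho e0) = letter e0.
    have : 0 < #|porbit (flip_perm (orbit_graph t p) * rho) e0|.
      by rewrite lt0n cards_eq0; apply/set0Pn; exists e0; apply: porbit_id.
    by rewrite /face_word; case: #|_|.
  by rewrite -!head_word wd wd'.
rewrite -(card_in_imset inj) subset_leq_card //; apply/subsetP => _ /imsetP [d dD ->].
move: dD; rewrite inE => /andP [ld /eqP <-]; exact: light_fixed.
Qed.

Lemma euler_char_orbit_graph t d : forall K, exists N, forall n (p : hv_pair n),
  admissible d.+1 p -> N <= n -> (K <= absz (euler_char (orbit_graph t p)))%N.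
Proof.
(* Each of the [M] light words may fix 1/(84 M) of the orbit, so light darts number at most V/84.
   With 2 V edges, the Euler characteristic is F - V, at most - V/84, and the orbit is taken of size
   at least [84 * K]. *)
move=> K; pose M := size (light_words t).
have [N1 N1P] := orbit_large d (84 * K).
have [N2 N2P] : exists N, forall n (p : hv_pair n), admissible d.+1 p -> N <= n ->
    forall w, w \in light_words t ->
      84 * M * #|fixed_by p (class_word n (letters_word t w))| <= #|orbit_vertex p|.
  have nf_words w : w \in map (letters_word t) (light_words t) -> nf w != nf_one.
    by move=> /mapP [v + ->]; rewrite mem_filter => /andP [].
  have [N NP] := rare_words nf_words d (84 * M).
  by exists N => n p gp Nn w ww; apply: NP => //; apply: map_f.
exists (maxn N1 N2) => n p gp; rewrite geq_max => /andP [/(N1P n p gp) VK /(N2P n p gp) few].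
have light_few rho : rotation_system rho -> 84 * #|[set e : dart (orbit_graph t p) | light
  rho e]| <= #|orbit_vertex p|.
  move=> rot; have := card_light rot; have [M0|M0] := posnP M.
    by rewrite (size0nil M0) big_nil leqn0 => /eqP ->; rewrite muln0.
  move=> le; rewrite -(leq_pmul2l M0) mulnCA mulnA.
  apply: leq_trans (leq_mul (leqnn (84 * M)%N) le) _; rewrite big_distrr /=.
  have -> : (M * #|orbit_vertex p| = \sum_(w <- light_words t) #|orbit_vertex p|)%N.
    by rewrite big_const_seq count_predT iter_addn_0 mulnC.
  by rewrite big_seq [X in _ <= X]big_seq; apply: leq_sum => w /few.
have max_faces : 84 * \max_(rho : {perm dart (orbit_graph t p)} | rotation_system rho)
  num_faces rho
    <= 83 * #|orbit_vertex p|.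
  rewrite mulnC -leq_divRL //; apply/bigmax_leqP => rho rot; rewrite leq_divRL //.
  by have := num_faces_light rot; have := light_few rho rot; lia.
rewrite /euler_char.
have -> : #|edge (orbit_graph t p)| = (2 * #|orbit_vertex p|)%N.
  by rewrite card_prod card_bool mulnC.
move: max_faces; set m := \max_(_ | _) _.
have -> : #|vertex (orbit_graph t p)| = #|orbit_vertex p| by apply: eq_card.
move: VK; set V := #|_| => VK mV; lia.
Qed.

Local Close Scope group_scope.

Theorem theorem1p2 (R : realType) (l : locus) (t : generator_pair)
    (I : pred nat) (o : forall n : nat, hv_pair n)
    (Ho : forall n : nat, I n -> primitive_origami (o n) /\ in_locus R l (o n)) :
  forall K : nat, exists N : nat, forall n : nat, I n -> (N <= n)%N ->
    (K <= absz (euler_char (orbit_graph t (o n))))%N.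
Proof.
move=> K.
have [k k0 inK] : exists2 k, (0 < k)%N &
    forall n (p : hv_pair n), in_locus R l p -> in_stratum p [:: k].
  by case: l {Ho} => /=; [exists 2 | exists 4 | exists 6] => // n p [].
have [N NP] := euler_char_orbit_graph t k K.
exists N => n In Nn; apply: NP => //; have [prim /inK] := Ho n In.
exact: admissible_of_stratum.
Qed.
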